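(* The commutator subgroup $[F_{\mathrm{br}},F_{\mathrm{br}}]$ is perfect.
   Context: A tree means a finite rooted binary tree (every non-leaf vertex has a left and a right child; the one-vertex tree is allowed); its leaves are numbered $1,\dots,n$ from left to right. $T\cup\lambda_k$ denotes the tree obtained from $T$ by attaching a caret (a vertex with two children) to its $k$-th leaf. $PB_n$ is the pure braid group on $n$ strands, drawn top to bottom, with product $pq$ meaning $p$ stacked on top of $q$. The cloning map $\kappa_k^n\colon PB_n\to PB_{n+1}$ replaces the $k$-th strand by two parallel strands. $F_{\mathrm{br}}$ is the set of equivalence classes of triples $(T_-,p,T_+)$, with $T_\pm$ trees with the same number $n$ of leaves and $p\in PB_n$, under the equivalence relation generated by the expansions $(T_-,p,T_+)\sim(T_-\cup\lambda_k,\kappa_k^n(p),T_+\cup\lambda_k)$, $1\le k\le n$. It is a group under the multiplication determined by $(T,p,S)(S,q,U)=(T,pq,U)$ (any two elements can be expanded so that this applies). *)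

(* Defs.v *)
From Stdlib Require Import Relation_Operators.
From HB Require Import structures.
From mathcomp Require Import all_boot all_fingroup.
From mathcomp Require Import generic_quotient.
From mathcomp Require Import zify.
From mathcomp Require Import boolp classical_sets.

Set Implicit Arguments.
Unset Strict Implicit.
Unset Printing Implicit Defensive.

Local Open Scope group_scope.

(* Artin's presentation.  Strands and positions are numbered from 0; the letter
   (i, false) stands for sigma_i, in which the strands at positions i and i.+1
   cross, and (i, true) for its inverse.  A word is read from the top of the
   braid to its bottom, so that concatenation is stacking. *)
Definition letter (n : nat) : Type := ('I_n.-1 * bool)%type.
Definition braid_word (n : nat) : Type := seq (letter n).

Inductive braid_rule n : braid_word n -> braid_word n -> Prop :=
| BraidCancel (i : 'I_n.-1) (e : bool) :
    braid_rule [:: (i, e); (i, ~~ e)] [::]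
| BraidFar (i j : 'I_n.-1) : (i.+1 < j)%N ->
    braid_rule [:: (i, false); (j, false)] [:: (j, false); (i, false)]
| BraidYB (i j : 'I_n.-1) : j = i.+1 :> nat ->
    braid_rule [:: (i, false); (j, false); (i, false)]
               [:: (j, false); (i, false); (j, false)].

Inductive braid_step n : braid_word n -> braid_word n -> Prop :=
| BraidStep (u v a b : braid_word n) : braid_rule a b ->
    braid_step (u ++ a ++ v) (u ++ b ++ v).

Definition braid_eq n : braid_word n -> braid_word n -> Prop :=
  clos_refl_sym_trans _ (@braid_step n).

Definition braid_eqb n : rel (braid_word n) := fun u v => `[< braid_eq u v >].

Lemma braid_eqb_refl n : reflexive (@braid_eqb n).
Proof. by move=> u; apply/asboolP; apply: rst_refl. Qed.

Lemma braid_eqb_sym n : symmetric (@braid_eqb n).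
Proof. by move=> u v; apply/asboolP/asboolP; apply: rst_sym. Qed.

Lemma braid_eqb_trans n : transitive (@braid_eqb n).
Proof.
move=> v u w /asboolP uv /asboolP vw; apply/asboolP.
exact: (rst_trans _ _ _ _ _ uv vw).
Qed.

Canonical braid_equiv n :=
  EquivRel (@braid_eqb n) (@braid_eqb_refl n) (@braid_eqb_sym n)
    (@braid_eqb_trans n).

Definition braid (n : nat) : Type := {eq_quot (@braid_eqb n)}%qT.
HB.instance Definition _ n := Choice.on (braid n).
HB.instance Definition _ n := Quotient.on (braid n).

Definition cls n (w : braid_word n) : braid n := (\pi_(braid n) w)%qT.

Lemma clsP n (u v : braid_word n) : reflect (braid_eq u v) (cls u == cls v).
Proof.
apply: (iffP eqP) => [/eqmodP/asboolP //|uv].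
by apply/eqmodP/asboolP.
Qed.

Lemma clsK n (b : braid n) : cls (repr b) = b.
Proof. exact: reprK. Qed.

Lemma braid_eq_repr n (w : braid_word n) : braid_eq (repr (cls w)) w.
Proof. by apply/clsP; rewrite clsK. Qed.

Definition winv n (w : braid_word n) : braid_word n :=
  rev [seq (l.1, ~~ l.2) | l <- w].

Lemma braid_eq_ctx n (u v a b : braid_word n) :
  braid_eq a b -> braid_eq (u ++ a ++ v) (u ++ b ++ v).
Proof.
elim=> {a b}[_ _ [u' v' a b r]|a|a b _ IH|a b c _ IH1 _ IH2].
- apply: rst_step; have := BraidStep (u ++ u') (v' ++ v) r.
  by rewrite -!catA.
- exact: rst_refl.
- exact: rst_sym.
- exact: rst_trans IH1 IH2.
Qed.

Lemma braid_eq_cat n (a b c d : braid_word n) :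
  braid_eq a b -> braid_eq c d -> braid_eq (a ++ c) (b ++ d).
Proof.
move=> ab cd; apply: (@rst_trans _ _ _ (b ++ c)).
  exact: (@braid_eq_ctx n [::] c).
by have := @braid_eq_ctx n b [::] _ _ cd; rewrite !cats0.
Qed.

Lemma braid_eq_rule n (a b : braid_word n) : braid_rule a b -> braid_eq a b.
Proof.
by move=> r; apply: rst_step; have := BraidStep [::] [::] r; rewrite /= !cats0.
Qed.

Lemma winv_cat n (u v : braid_word n) : winv (u ++ v) = winv v ++ winv u.
Proof. by rewrite /winv map_cat rev_cat. Qed.

Lemma winvK n : involutive (@winv n).
Proof.
move=> w; rewrite /winv map_rev revK -map_comp -[RHS]map_id.
by apply: eq_map => -[i e] /=; rewrite negbK.
Qed.

Lemma winvV n (w : braid_word n) : braid_eq (w ++ winv w) [::].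
Proof.
elim: w => [|[i e] w IH]; first exact: rst_refl.
rewrite -cat1s winv_cat -!catA (catA w).
apply: (@rst_trans _ _ _ ([:: (i, e)] ++ [::] ++ winv [:: (i, e)])).
  exact: braid_eq_ctx.
by apply: braid_eq_rule; apply: BraidCancel.
Qed.

Lemma winvVl n (w : braid_word n) : braid_eq (winv w ++ w) [::].
Proof. by have := winvV (winv w); rewrite winvK. Qed.

Definition braid_one n : braid n := cls [::].
Definition braid_mul n (x y : braid n) : braid n := cls (repr x ++ repr y).
Definition braid_inv n (x : braid n) : braid n := cls (winv (repr x)).

Lemma braid_mulE n (u v : braid_word n) :
  braid_mul (cls u) (cls v) = cls (u ++ v).
Proof. by apply/eqP/clsP; apply: braid_eq_cat; apply: braid_eq_repr. Qed.

Lemma braid_mulA n : associative (@braid_mul n).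
Proof.
move=> x y z; rewrite -(clsK x) -(clsK y) -(clsK z) !braid_mulE.
by rewrite catA.
Qed.

Lemma braid_mul1 n : left_id (@braid_one n) (@braid_mul n).
Proof. by move=> x; rewrite -(clsK x) braid_mulE. Qed.

Lemma braid_mulr1 n : right_id (@braid_one n) (@braid_mul n).
Proof. by move=> x; rewrite -(clsK x) braid_mulE cats0. Qed.

Lemma braid_mulV n : left_inverse (@braid_one n) (@braid_inv n) (@braid_mul n).
Proof.
move=> x; rewrite /braid_inv -{2}(clsK x) braid_mulE.
by apply/eqP/clsP; apply: winvVl.
Qed.

Lemma braid_mulrV n : right_inverse (@braid_one n) (@braid_inv n) (@braid_mul n).
Proof.
move=> x; rewrite /braid_inv -{1}(clsK x) braid_mulE.
by apply/eqP/clsP; apply: winvV.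
Qed.

HB.instance Definition _ n :=
  isGroup.Build (braid n) (@braid_mulA n) (@braid_mul1 n) (@braid_mulr1 n)
    (@braid_mulV n) (@braid_mulrV n).

Lemma cls_cat n (u v : braid_word n) : cls (u ++ v) = cls u * cls v.
Proof. by rewrite -braid_mulE. Qed.

Lemma cls_nil n : cls [::] = 1 :> braid n.
Proof. by []. Qed.

Definition lpos n (i : 'I_n.-1) : 'I_n := widen_ord (leq_pred n) i.

Lemma rpos_subproof n (i : 'I_n.-1) : (i.+1 < n)%N.
Proof. by case: n i => [[]|n [i]] //=. Qed.

Definition rpos n (i : 'I_n.-1) : 'I_n := Ordinal (rpos_subproof i).

Definition letter_perm n (l : letter n) : 'S_n := tperm (lpos l.1) (rpos l.1).

(* Sends the position of a strand at the top to its position at the bottom. *)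
Definition word_perm n (w : braid_word n) : 'S_n :=
  \prod_(l <- w) letter_perm l.

Definition braid_perm n (b : braid n) : 'S_n := word_perm (repr b).

Lemma word_perm_cat n (u v : braid_word n) :
  word_perm (u ++ v) = word_perm u * word_perm v.
Proof. by rewrite /word_perm big_cat. Qed.

Definition nswap (i k : nat) : nat :=
  if k == i then i.+1 else if k == i.+1 then i else k.

Lemma letter_permE n (l : letter n) (k : 'I_n) :
  letter_perm l k = nswap l.1 k :> nat.
Proof.
rewrite /letter_perm permE /= /nswap -!val_eqE /=.
by case: eqP => // _; case: eqP.
Qed.

Lemma word_perm_cons n (l : letter n) (w : braid_word n) :
  word_perm (l :: w) = letter_perm l * word_perm w.
Proof. by rewrite /word_perm big_cons. Qed.

Lemma word_perm_nil n : word_perm [::] = 1 :> 'S_n.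
Proof. by rewrite /word_perm big_nil. Qed.

Lemma word_perm_rule n (a b : braid_word n) :
  braid_rule a b -> word_perm a = word_perm b.
Proof.
case=> [i e|i j ij|i j ij]; rewrite !word_perm_cons !word_perm_nil;
  apply/permP => k; apply: val_inj; rewrite /= !permM !perm1 !letter_permE /=.
- by rewrite /nswap; do !case: eqP; lia.
- by rewrite /nswap; do !case: eqP; lia.
- by rewrite /nswap ij; do !case: eqP; lia.
Qed.

Lemma word_perm_eq n (a b : braid_word n) :
  braid_eq a b -> word_perm a = word_perm b.
Proof.
elim=> {a b}[_ _ [u v a b r]|a|a b _ ->|a b c _ -> _ ->] //.
by rewrite !word_perm_cat (word_perm_rule r).
Qed.

Lemma braid_perm_cls n (w : braid_word n) : braid_perm (cls w) = word_perm w.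
Proof. exact/word_perm_eq/braid_eq_repr. Qed.

Lemma braid_permM n (x y : braid n) :
  braid_perm (x * y) = braid_perm x * braid_perm y.
Proof.
by rewrite -(clsK x) -(clsK y) -cls_cat !braid_perm_cls word_perm_cat.
Qed.

Lemma braid_perm1 n : braid_perm (1 : braid n) = 1.
Proof. by rewrite -cls_nil braid_perm_cls word_perm_nil. Qed.

Lemma braid_permV n (x : braid n) : braid_perm x^-1 = (braid_perm x)^-1.
Proof.
by apply/esym/eqP; rewrite eq_invg_mul -braid_permM mulgV braid_perm1.
Qed.

Definition pure n : pred (braid n) := fun b => braid_perm b == 1.

Record PB (n : nat) := PureBraid { pbval :> braid n; _ : pure pbval }.
HB.instance Definition _ n := [isSub of PB n for @pbval n].
HB.instance Definition _ n := [Choice of PB n by <:].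

Lemma pure_closed n : group_closed (@pure n).
Proof.
split; first by rewrite /in_mem /= /pure braid_perm1.
move=> x y; rewrite /in_mem /= /pure => /eqP px /eqP py.
by rewrite braid_permM braid_permV px py invg1 mulg1.
Qed.

HB.instance Definition _ n :=
  SubChoice_isSubGroup.Build (braid n) (@pure n) (PB n) (@pure_closed n).

(* The letters obtained from (i, e) by doubling the strand which enters at
   position k.  The type 'I_n.+1.-1 indexing the letters on n.+1 strands is
   convertible to 'I_n, so that lpos i and rpos i stand for sigma_i and
   sigma_(i+1) there. *)
Definition clone_letter n (k : 'I_n) (l : letter n) : braid_word n.+1 :=
  let: (i, e) := l in
  if (k < i)%N then [:: (rpos i, e)]
  else if k == lpos i then [:: (rpos i, e); (lpos i, e)]
  else if k == rpos i then [:: (lpos i, e); (rpos i, e)]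
  else [:: (lpos i, e)].

Fixpoint clone_word n (k : 'I_n) (w : braid_word n) : braid_word n.+1 :=
  if w is l :: w' then clone_letter k l ++ clone_word (letter_perm l k) w'
  else [::].

(* On a braid which is not pure this is not a morphism, see cloneM. *)
Definition clone n (k : 'I_n) (b : braid n) : braid n.+1 :=
  cls (clone_word k (repr b)).

(* [nword], [nclone] and [nperm] mirror words, [clone_word] and [word_perm] on
   unbounded indices: positions are then plain numbers, open to [lia]. *)
Definition gen n (j : nat) : braid n :=
  if insub j is Some i then cls [:: (i : 'I_n.-1, false)] else 1.

Definition sgen n (l : nat * bool) : braid n :=
  if l.2 then (gen n l.1)^-1 else gen n l.1.

Definition neval n (w : seq (nat * bool)) : braid n := \prod_(l <- w) sgen n l.

Definition nword n (w : braid_word n) : seq (nat * bool) :=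
  [seq (nat_of_ord l.1, l.2) | l <- w].

Definition nclone_letter (k : nat) (l : nat * bool) : seq (nat * bool) :=
  let: (i, e) := l in
  if (k < i)%N then [:: (i.+1, e)]
  else if k == i then [:: (i.+1, e); (i, e)]
  else if k == i.+1 then [:: (i, e); (i.+1, e)]
  else [:: (i, e)].

Fixpoint nclone (k : nat) (w : seq (nat * bool)) : seq (nat * bool) :=
  if w is l :: w' then nclone_letter k l ++ nclone (nswap l.1 k) w'
  else [::].

Fixpoint nperm (w : seq (nat * bool)) (k : nat) : nat :=
  if w is l :: w' then nperm w' (nswap l.1 k) else k.

Lemma gen_ord n (i : 'I_n.-1) : gen n i = cls [:: (i, false)].
Proof. by rewrite /gen valK. Qed.

Lemma cls_letterV n (i : 'I_n.-1) :
  cls [:: (i, true)] = (cls [:: (i, false)])^-1.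
Proof.
apply/eqP; rewrite -[X in _ == X]mulg1 -(inj_eq (mulgI (cls [:: (i, false)]))).
rewrite mulKVg -cls_cat; apply/clsP; apply: braid_eq_rule.
exact: (BraidCancel i false).
Qed.

Lemma cls_neval n (w : braid_word n) : cls w = neval n (nword w).
Proof.
rewrite /neval; elim: w => [|[i e] w IH]; first by rewrite big_nil.
rewrite big_cons -IH -cat1s cls_cat; congr (_ * _).
by rewrite /sgen /=; case: e; rewrite gen_ord // cls_letterV.
Qed.

Lemma neval_cat n u v : neval n (u ++ v) = neval n u * neval n v.
Proof. by rewrite /neval big_cat. Qed.

Lemma neval_cons n l v : neval n (l :: v) = sgen n l * neval n v.
Proof. by rewrite /neval big_cons. Qed.

Lemma neval_nil n : neval n [::] = 1.
Proof. by rewrite /neval big_nil. Qed.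

Lemma nword_clone n (k : 'I_n) (w : braid_word n) :
  nword (clone_word k w) = nclone k (nword w).
Proof.
elim: w k => [|[i e] w IH] k //=.
rewrite /nword map_cat -/(nword _) -/(nword _) IH letter_permE.
congr (_ ++ _); rewrite -!val_eqE /=.
by case: ltnP => // _; case: eqP => // _; case: eqP.
Qed.

Lemma nword_perm n (w : braid_word n) (k : 'I_n) :
  word_perm w k = nperm (nword w) k :> nat.
Proof.
elim: w k => [|l w IH] k /=; first by rewrite word_perm_nil perm1.
by rewrite word_perm_cons permM IH letter_permE.
Qed.

Lemma gen_lt n i (h : (i < n.-1)%N) : gen n i = cls [:: (Ordinal h, false)].
Proof. exact: (gen_ord (Ordinal h)). Qed.

Lemma gen_out n i : (n.-1 <= i)%N -> gen n i = 1.
Proof. by move=> h; rewrite /gen insubF // ltnNge h. Qed.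

Lemma gen_far n i j : (i.+1 < j)%N -> commute (gen n i) (gen n j).
Proof.
move=> ij; have [hi|/gen_out->] := ltnP i n.-1; last first.
  by rewrite /commute mul1g mulg1.
have [hj|/gen_out->] := ltnP j n.-1; last by rewrite /commute mul1g mulg1.
rewrite !gen_lt /commute -!cls_cat; apply/eqP/clsP/braid_eq_rule.
exact: BraidFar.
Qed.

Lemma gen_braid n i : (i.+2 < n)%N ->
  gen n i * (gen n i.+1 * gen n i) = gen n i.+1 * (gen n i * gen n i.+1).
Proof.
move=> lt; have hi : (i < n.-1)%N by lia. have hj : (i.+1 < n.-1)%N by lia.
rewrite !gen_lt -!cls_cat; apply/eqP/clsP/braid_eq_rule.
exact: BraidYB.
Qed.

Lemma sgen_far n i j e f : (i.+1 < j)%N -> commute (sgen n (i, e)) (sgen n (j, f)).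
Proof.
move=> /(@gen_far n) c; rewrite /sgen /=.
case: f; last by case: e => //; apply/commute_sym/commuteV/commute_sym.
by apply: commuteV; case: e => //; apply/commute_sym/commuteV/commute_sym.
Qed.
Lemma clone_word_cat n (k : 'I_n) (u v : braid_word n) :
  clone_word k (u ++ v) = clone_word k u ++ clone_word (word_perm u k) v.
Proof.
elim: u k => [|l u IH] k; first by rewrite /= word_perm_nil perm1.
by rewrite /= IH word_perm_cons permM catA.
Qed.

Lemma nclone_cat k u v :
  nclone k (u ++ v) = nclone k u ++ nclone (nperm u k) v.
Proof. by elim: u k => [|l u IH] k //=; rewrite IH catA. Qed.

Lemma nclone_cons k i e w :
  nclone k ((i, e) :: w) = nclone_letter k (i, e) ++ nclone (nswap i k) w.
Proof. by []. Qed.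

Lemma nperm_cons k i e w : nperm ((i, e) :: w) k = nperm w (nswap i k).
Proof. by []. Qed.

Lemma sgenV n i e : sgen n (i, e) * sgen n (i, ~~ e) = 1.
Proof. by rewrite /sgen; case: e => /=; rewrite ?mulgV ?mulVg. Qed.

Variant nclone_spec (i : nat) (e : bool) (k : nat) :
  nat -> seq (nat * bool) -> Prop :=
| NcloneLt of (k < i)%N : nclone_spec i e k k [:: (i.+1, e)]
| NcloneL of k = i : nclone_spec i e k i.+1 [:: (i.+1, e); (i, e)]
| NcloneR of k = i.+1 : nclone_spec i e k i [:: (i, e); (i.+1, e)]
| NcloneGt of (i.+1 < k)%N : nclone_spec i e k k [:: (i, e)].

Lemma ncloneP i e k : nclone_spec i e k (nswap i k) (nclone_letter k (i, e)).
Proof.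
rewrite /nclone_letter /nswap; case: ltngtP => [h|h|->].
- by rewrite ifF; [constructor|lia].
- by case: eqP => [->|?]; constructor; lia.
- by constructor.
Qed.

Ltac ncases := rewrite ?nclone_cons ?nperm_cons; repeat
  (match goal with
   | |- context [nclone_letter ?k (?i, ?e)] =>
     lazymatch k with context [nswap] => fail | _ => idtac end;
     case: (ncloneP i e k) => ?; subst; try (exfalso; lia)
   | |- context [nswap ?i ?k] =>
     lazymatch k with context [nswap] => fail | _ => idtac end;
     case: (ncloneP i false k) => ?; subst; try (exfalso; lia)
   end; rewrite ?nclone_cons ?nperm_cons).

Lemma gen_yb_clone n i k : (i.+2 < n)%N ->
  neval n.+1 (nclone k [:: (i, false); (i.+1, false); (i, false)]) =
  neval n.+1 (nclone k [:: (i.+1, false); (i, false); (i.+1, false)]).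
Proof.
move=> lt.
have B0 : (i.+2 < n.+1)%N -> _ := @gen_braid n.+1 i.
have B1 : (i.+3 < n.+1)%N -> _ := @gen_braid n.+1 i.+1.
have {}B0 := B0 (ltnW lt); have {}B1 := B1 lt.
have C : commute (gen n.+1 i) (gen n.+1 i.+2) by apply: gen_far.
rewrite /commute in C.
have Cx x : gen n.+1 i * (gen n.+1 i.+2 * x) = gen n.+1 i.+2 * (gen n.+1 i * x).
  by rewrite !mulgA C.
have B0x x : gen n.+1 i * (gen n.+1 i.+1 * (gen n.+1 i * x)) =
   gen n.+1 i.+1 * (gen n.+1 i * (gen n.+1 i.+1 * x)).
  by have := congr1 (mulg^~ x) B0; rewrite -!mulgA.
have B1x x : gen n.+1 i.+1 * (gen n.+1 i.+2 * (gen n.+1 i.+1 * x)) =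
   gen n.+1 i.+2 * (gen n.+1 i.+1 * (gen n.+1 i.+2 * x)).
  by have := congr1 (mulg^~ x) B1; rewrite -!mulgA.
ncases; rewrite /= !neval_cons !neval_nil /sgen /= !mulg1.
- by [].
- by rewrite !Cx B0 B1x.
- by rewrite B1x Cx -C B0x.
- by rewrite -!Cx B0x B1.
- by [].
Qed.

Lemma nclone_far n i j k : (i.+1 < j)%N ->
  neval n (nclone k [:: (i, false); (j, false)]) =
  neval n (nclone k [:: (j, false); (i, false)]).
Proof.
move=> ij.
have C a b : (a.+1 < b)%N -> gen n a * gen n b = gen n b * gen n a.
  exact: gen_far.
have Cx a b x : (a.+1 < b)%N ->
    gen n a * (gen n b * x) = gen n b * (gen n a * x).
  by move=> ab; rewrite !mulgA C.
ncases; rewrite /= !neval_cons !neval_nil /sgen /= !mulg1.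
all: do ?[rewrite C; last lia | rewrite Cx; last lia]; by [].
Qed.

Lemma nclone_cancel n i e k :
  neval n (nclone k [:: (i, e); (i, ~~ e)]) = 1.
Proof.
have V a : sgen n (a, e) * sgen n (a, ~~ e) = 1 by exact: sgenV.
have Vx a x : sgen n (a, e) * (sgen n (a, ~~ e) * x) = x.
  by rewrite mulgA V mul1g.
by ncases; rewrite /= !neval_cons !neval_nil !mulg1 ?Vx ?V.
Qed.

Lemma clone_word_rule n (k : 'I_n) (a b : braid_word n) :
  braid_rule a b -> cls (clone_word k a) = cls (clone_word k b).
Proof.
case=> [i e|i j ij|i j ij]; rewrite !cls_neval !nword_clone.
- by rewrite (nclone_cancel n.+1 i e k) /= neval_nil.
- exact: (nclone_far n.+1 k ij).
- have := @gen_yb_clone n i k; rewrite /= ij; apply.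
  by have := ltn_ord j; rewrite ij; clear; lia.
Qed.

Lemma clone_word_eq n (k : 'I_n) (a b : braid_word n) :
  braid_eq a b -> cls (clone_word k a) = cls (clone_word k b).
Proof.
elim=> {a b}[_ _ [u v a b r]|a|a b _ ->|a b c _ -> _ ->] //.
rewrite !clone_word_cat !cls_cat (clone_word_rule _ r).
by rewrite (word_perm_rule r).
Qed.

Lemma clone_cls n (k : 'I_n) (w : braid_word n) :
  clone k (cls w) = cls (clone_word k w).
Proof. exact/clone_word_eq/braid_eq_repr. Qed.

Lemma cloneM n (k : 'I_n) (x y : braid n) :
  clone k (x * y) = clone k x * clone (braid_perm x k) y.
Proof.
rewrite -(clsK x) -(clsK y) -cls_cat !clone_cls braid_perm_cls.
by rewrite clone_word_cat cls_cat.
Qed.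

(* The position, once strand l has been doubled, of (a copy of) strand k. *)
Definition nbump (l k : nat) : nat := (k + (l < k))%N.

Lemma nperm_cat u v x : nperm (u ++ v) x = nperm v (nperm u x).
Proof. by elim: u x => [|? u IHu] x //=. Qed.

Lemma nswap_bump i e l k : k != l ->
  nperm (nclone_letter l (i, e)) (nbump l k) = nbump (nswap i l) (nswap i k).
Proof.
by rewrite /nbump => kl; ncases; rewrite /=; ncases; lia.
Qed.

Lemma nswap_dbl i e l :
  nperm (nclone_letter l (i, e)) l = nswap i l /\
  nperm (nclone_letter l (i, e)) l.+1 = (nswap i l).+1.
Proof.
by case: (ncloneP i e l) => ?; rewrite /=; ncases; split; lia.
Qed.

Lemma nperm_clone w l k : k != l ->
  nperm (nclone l w) (nbump l k) = nbump (nperm w l) (nperm w k) /\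
  nperm w k != nperm w l.
Proof.
elim: w l k => [|[i e] w IH] l k kl //.
have kl' : nswap i k != nswap i l by rewrite /nswap; do !case: eqP; lia.
by rewrite nclone_cons !nperm_cons nperm_cat nswap_bump //; apply: IH.
Qed.

Lemma nperm_clone_dbl w l :
  nperm (nclone l w) l = nperm w l /\ nperm (nclone l w) l.+1 = (nperm w l).+1.
Proof.
elim: w l => [|[i e] w IH] l //.
rewrite nclone_cons !nperm_cons !nperm_cat; have [-> ->] := nswap_dbl i e l.
exact: IH.
Qed.

Lemma pure_clone n (k : 'I_n) (b : braid n) : pure b -> pure (clone k b).
Proof.
rewrite -(clsK b) clone_cls /pure !braid_perm_cls; move: (repr b) => w.
move=> /eqP w1; apply/eqP/permP => j; rewrite perm1; apply: val_inj.
rewrite /= nword_perm nword_clone.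
have fix1 (i : 'I_n) : nperm (nword w) i = i by rewrite -nword_perm w1 perm1.
have [j1 j2] := nperm_clone_dbl (nword w) k.
have [->|jk] := eqVneq (j : nat) k; first by rewrite j1 fix1.
have [->|jk1] := eqVneq (j : nat) k.+1; first by rewrite j2 fix1.
have ub : (unbump k j < n)%N.
  by rewrite /unbump; have := ltn_ord j; have := ltn_ord k; lia.
have [|E _] := @nperm_clone (nword w) k (Ordinal ub).
  by rewrite /= /unbump; lia.
move: E; rewrite !fix1 /nbump /= /unbump.
by have -> : (j - (k < j) + (k < j - (k < j)) = j)%N by lia.
Qed.

Lemma nclone_letter_comm n i e k l : k != l ->
  neval n (nclone (nbump l k) (nclone_letter l (i, e))) =
  neval n (nclone (nbump k l) (nclone_letter k (i, e))).
Proof.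
wlog kl : k l / (k < l)%N => [H kl|_].
  have [/H|lt|E] := ltngtP k l; [exact| |by rewrite E eqxx in kl].
  by rewrite (H l k) // eq_sym.
have -> : nbump l k = k by rewrite /nbump; lia.
have -> : nbump k l = l.+1 by rewrite /nbump; lia.
have C a b : (a.+1 < b)%N ->
    sgen n (a, e) * sgen n (b, e) = sgen n (b, e) * sgen n (a, e).
  exact: sgen_far.
have Cx a b x : (a.+1 < b)%N ->
    sgen n (a, e) * (sgen n (b, e) * x) = sgen n (b, e) * (sgen n (a, e) * x).
  by move=> ab; rewrite !mulgA C.
ncases; rewrite /= !neval_cons !neval_nil !mulg1 //.
by rewrite (Cx i i.+2).
Qed.

Lemma nclone_comm n w k l : k != l ->
  neval n (nclone (nbump l k) (nclone l w)) =
  neval n (nclone (nbump k l) (nclone k w)).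
Proof.
elim: w k l => [|[i e] w IH] k l kl //.
rewrite !nclone_cons !nclone_cat !neval_cat nclone_letter_comm //; congr (_ * _).
have := @nperm_clone [:: (i, e)] l k kl.
have := @nperm_clone [:: (i, e)] k l; rewrite eq_sym => /(_ kl).
rewrite !nclone_cons /= !cats0 => -[-> _] [-> kl'].
exact: IH.
Qed.

Lemma clone_comm n (k l : 'I_n) (k' l' : 'I_n.+1) (b : braid n) :
  k != l -> k' = nbump l k :> nat -> l' = nbump k l :> nat ->
  clone k' (clone l b) = clone l' (clone k b).
Proof.
move=> kl Ek El; rewrite -(clsK b) !clone_cls !cls_neval !nword_clone Ek El.
exact: nclone_comm.
Qed.

Definition kappa n (k : 'I_n) (p : PB n) : PB n.+1 :=
  PureBraid (pure_clone k (valP p)).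

Lemma kappaM n (k : 'I_n) : {morph kappa k : p q / p * q}.
Proof.
move=> p q; apply: val_inj; rewrite /= cloneM.
by have /eqP-> := valP p; rewrite perm1.
Qed.
Lemma kappa_comm n (k l : 'I_n) (k' l' : 'I_n.+1) (p : PB n) :
  k != l -> k' = nbump l k :> nat -> l' = nbump k l :> nat ->
  kappa k' (kappa l p) = kappa l' (kappa k p).
Proof. by move=> kl Ek El; apply: val_inj; apply: clone_comm. Qed.

Lemma kappa1 n (k : 'I_n) : kappa k 1 = 1.
Proof. by apply: (mulgI (kappa k 1)); rewrite -kappaM !mulg1. Qed.

Lemma kappaV n (k : 'I_n) (p : PB n) : kappa k p^-1 = (kappa k p)^-1.
Proof. by apply: (mulgI (kappa k p)); rewrite -kappaM !mulgV kappa1. Qed.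

Inductive tree : Type := Leaf | Node of tree & tree.

Fixpoint leaves (T : tree) : nat :=
  if T is Node L R then (leaves L + leaves R)%N else 1%N.

(* Attaches a caret to leaf k, the leaves being numbered from 0 and from left
   to right. *)
Fixpoint add_caret (T : tree) (k : nat) : tree :=
  match T with
  | Leaf => Node Leaf Leaf
  | Node L R =>
    if (k < leaves L)%N then Node (add_caret L k) R
    else Node L (add_caret R (k - leaves L))
  end.

Lemma leaves_add_caret T k : leaves (add_caret T k) = (leaves T).+1.
Proof.
by elim: T k => [|L IHL R IHR] k //=; case: ifP => _ /=; rewrite ?IHL ?IHR; lia.
Qed.

Lemma leaves_gt0 T : (0 < leaves T)%N.
Proof. by elim: T => //= L hL R hR; lia. Qed.

Ltac iflia := case: ifP => ?; try (exfalso; unfold nbump in *; lia).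

Lemma add_caret_comm T (k l : nat) : k != l -> (k < leaves T)%N -> (l < leaves T)%N ->
  add_caret (add_caret T l) (nbump l k) = add_caret (add_caret T k) (nbump k l).
Proof.
elim: T k l => [|L IHL R IHR] k l kl /=; first by lia.
move=> kT lT; case: (ltnP k (leaves L)) => hk; case: (ltnP l (leaves L)) => hl /=;
  rewrite ?leaves_add_caret; do 2 iflia.
- by rewrite IHL.
- by congr (Node (add_caret _ _) (add_caret _ _)); rewrite /nbump; lia.
- by congr (Node (add_caret _ _) (add_caret _ _)); rewrite /nbump; lia.
- congr (Node _ _); have := IHR (k - leaves L)%N (l - leaves L)%N.
  have -> : (nbump l k - leaves L = nbump (l - leaves L) (k - leaves L))%N.
    by rewrite /nbump; lia.
  have -> : (nbump k l - leaves L = nbump (k - leaves L) (l - leaves L))%N.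
    by rewrite /nbump; lia.
  by apply; lia.
Qed.

Fixpoint tle (T R : tree) : bool :=
  match T, R with
  | Leaf, _ => true
  | Node _ _, Leaf => false
  | Node a b, Node c d => tle a c && tle b d
  end.

Fixpoint tjoin (T S : tree) : tree :=
  match T, S with
  | Leaf, _ => S
  | _, Leaf => T
  | Node a b, Node c d => Node (tjoin a c) (tjoin b d)
  end.

Lemma tle_refl T : tle T T.
Proof. by elim: T => //= L -> R ->. Qed.

Lemma tle_trans T S U : tle T S -> tle S U -> tle T U.
Proof.
elim: T S U => [|L IHL R IHR] [|a b] [|c d] //= /andP[h1 h2] /andP[h3 h4].
by rewrite (IHL a) // (IHR b).
Qed.

Lemma tle_joinl T S : tle T (tjoin T S).
Proof.
by elim: T S => [|L IHL R IHR] [|a b] //=; rewrite ?tle_refl // IHL IHR.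
Qed.

Lemma tle_joinr T S : tle S (tjoin T S).
Proof.
by elim: T S => [|L IHL R IHR] [|a b] //=; rewrite ?tle_refl // IHL IHR.
Qed.

Lemma tle_leaves T S : tle T S -> (leaves T <= leaves S)%N.
Proof.
elim: T S => [|L IHL R IHR] S; first by rewrite leaves_gt0.
by case: S => //= a b /andP[/IHL ? /IHR ?]; lia.
Qed.

Lemma tle_caret T k : tle T (add_caret T k).
Proof.
elim: T k => [|L IHL R IHR] k //=.
by case: ifP => _ /=; rewrite ?IHL ?IHR tle_refl.
Qed.

Lemma tle_ext T R : tle T R ->
  T = R \/ exists2 k, (k < leaves T)%N & tle (add_caret T k) R.
Proof.
elim: T R => [|L IHL R IHR] [|a b] //=; first by left.
  by move=> _; right; exists 0%N.
case/andP=> h1 h2; case: (IHL _ h1) => [<-|[k kL hk]]; last first.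
  by right; exists k; [lia|rewrite kL /= hk].
case: (IHR _ h2) => [<-|[k kR hk]]; first by left.
right; exists (k + leaves L)%N; first lia.
by rewrite ifF /= ?tle_refl ?addnK //; lia.
Qed.

Lemma tle_caret2 T R (k l : nat) : k != l -> (k < leaves T)%N -> (l < leaves T)%N ->
  tle (add_caret T k) R -> tle (add_caret T l) R ->
  tle (add_caret (add_caret T l) (nbump l k)) R.
Proof.
elim: T R k l => [|L IHL R' IHR] R k l kl /=; first by lia.
move=> kT lT; case: R => [|a b].
  by case: (ltnP k (leaves L)).
case: (ltnP k (leaves L)) => hk; case: (ltnP l (leaves L)) => hl /=;
    case/andP=> h1 h2 /andP[h3 h4]; rewrite ?leaves_add_caret; iflia => /=.
- by rewrite h4 andbT; apply: IHL.
- have -> : nbump l k = k by rewrite /nbump; lia.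
  by rewrite h1.
- have -> : (nbump l k - (leaves L).+1 = k - leaves L)%N by rewrite /nbump; lia.
  by rewrite h3.
- have -> : (nbump l k - leaves L = nbump (l - leaves L) (k - leaves L))%N.
    by rewrite /nbump; lia.
  by rewrite h1; apply: IHR => //; lia.
Qed.

Record triple := Triple {
  strands : nat;
  ltree : tree;
  tbraid : PB strands;
  rtree : tree;
  ltree_leaves : leaves ltree == strands;
  rtree_leaves : leaves rtree == strands
}.

Lemma expand_leaves (T : tree) n k :
  leaves T == n -> leaves (add_caret T k) == n.+1.
Proof. by rewrite leaves_add_caret eqSS. Qed.

Definition expand (x : triple) (k : 'I_(strands x)) : triple :=
  Triple (kappa k (tbraid x))
    (expand_leaves k (ltree_leaves x)) (expand_leaves k (rtree_leaves x)).

Definition Fbr_eq : triple -> triple -> Prop :=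
  clos_refl_sym_trans triple (fun x y => exists k, y = @expand x k).

Definition Fbr_eqb : rel triple := fun x y => `[< Fbr_eq x y >].

Lemma Fbr_eqb_refl : reflexive Fbr_eqb.
Proof. by move=> x; apply/asboolP; apply: rst_refl. Qed.

Lemma Fbr_eqb_sym : symmetric Fbr_eqb.
Proof. by move=> x y; apply/asboolP/asboolP; apply: rst_sym. Qed.

Lemma Fbr_eqb_trans : transitive Fbr_eqb.
Proof.
move=> y x z /asboolP xy /asboolP yz; apply/asboolP.
exact: (rst_trans _ _ _ _ _ xy yz).
Qed.

Canonical Fbr_equiv := EquivRel Fbr_eqb Fbr_eqb_refl Fbr_eqb_sym Fbr_eqb_trans.

HB.instance Definition _ := gen_eqMixin triple.
HB.instance Definition _ := gen_choiceMixin triple.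

Definition Fbr : Type := {eq_quot Fbr_eqb}%qT.
HB.instance Definition _ := Choice.on Fbr.
HB.instance Definition _ := Quotient.on Fbr.

Definition Fbr_class (x : triple) : Fbr := (\pi_Fbr x)%qT.

Lemma Fbr_classP (x y : triple) : Fbr_class x = Fbr_class y <-> Fbr_eq x y.
Proof.
split=> [/eqmodP/asboolP //|xy]; by apply/eqmodP/asboolP.
Qed.

Lemma Fbr_classK (X : Fbr) : Fbr_class (repr X) = X.
Proof. exact: reprK. Qed.

(* [stacked x y z]: x, y and z are of the form (T, p, S), (S, q, U) and
   (T, pq, U). *)
Variant stacked : triple -> triple -> triple -> Prop :=
| Stacked n T S U (p q : PB n) (hT : leaves T == n) (hS : leaves S == n)
    (hU : leaves U == n) :
    stacked (Triple p hT hS) (Triple q hS hU) (Triple (p * q) hT hU).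

Variant Fbr_product : Fbr -> Fbr -> Fbr -> Prop :=
| FbrProduct x y z : stacked x y z ->
    Fbr_product (Fbr_class x) (Fbr_class y) (Fbr_class z).

Definition Fbr_one : Fbr :=
  Fbr_class (Triple (1 : PB 1) (eqxx (leaves Leaf)) (eqxx (leaves Leaf))).

Definition tinv (x : triple) : triple :=
  Triple (tbraid x)^-1 (rtree_leaves x) (ltree_leaves x).

Definition Fbr_inv (X : Fbr) : Fbr := Fbr_class (tinv (repr X)).

(* There is exactly one such Z, see Fbr_mul_class and FbrM. *)
Definition Fbr_mul (X Y : Fbr) : Fbr :=
  xget Fbr_one [set Z | Fbr_product X Y Z].

Inductive red (x : triple) : triple -> Prop :=
| RedRefl : red x x
| RedStep k y : red (@expand x k) y -> red x y.

Lemma red_trans x y z : red x y -> red y z -> red x z.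
Proof. by elim=> // {}x k y' _ IH /IH; apply: RedStep. Qed.

Lemma red_step x k : red x (@expand x k).
Proof. exact: (RedStep (RedRefl _)). Qed.
Lemma triple_eq n (T S : tree) (p q : PB n) hT hT' hS hS' : p = q ->
  @Triple n T p S hT hS = @Triple n T q S hT' hS'.
Proof. by move=> ->; congr Triple; apply: eq_irrelevance. Qed.

Lemma red_strands x y : red x y -> x = y \/ (strands x < strands y)%N.
Proof.
elim=> [|{}x k {}y _ [<-|]] /=; [by left|by right|by right; lia].
Qed.

Lemma red_tle x y : red x y -> tle (rtree x) (rtree y).
Proof.
elim=> [{}x|{}x k {}y _ /= IH]; first exact: tle_refl.
exact: tle_trans (tle_caret _ _) IH.
Qed.

Lemma red_eq x y : red x y -> Fbr_eq x y.
Proof.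
elim=> [{}x|{}x k {}y _ IH]; first exact: rst_refl.
by apply: rst_trans IH; apply: rst_step; exists k.
Qed.

Lemma nbump_lt n (k l : 'I_n) : (nbump k l < n.+1)%N.
Proof. by rewrite /nbump; have := ltn_ord l; lia. Qed.

Lemma expand_comm x (k l : 'I_(strands x)) : k != l ->
  @expand (expand l) (Ordinal (nbump_lt l k)) =
  @expand (expand k) (Ordinal (nbump_lt k l)).
Proof.
case: x k l => n T p S hT hS /= k l kl; rewrite /expand /=.
move: (expand_leaves _ _) (expand_leaves _ _) (expand_leaves _ _) (expand_leaves _ _).
have kT : (k < leaves T)%N by rewrite (eqP hT).
have lT : (l < leaves T)%N by rewrite (eqP hT).
have kS : (k < leaves S)%N by rewrite (eqP hS).
have lS : (l < leaves S)%N by rewrite (eqP hS).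
rewrite !(@add_caret_comm _ k l) // => *; apply: triple_eq.
exact: kappa_comm.
Qed.

Lemma red_strip x k y : red x y ->
  exists2 z, red y z & red (@expand x k) z.
Proof.
move=> xy; elim: xy k => [{}x|{}x l {}y ly IH] k.
  by exists (expand k); [apply: red_step|apply: RedRefl].
have [->|kl] := eqVneq k l; first by exists y; [apply: RedRefl|].
have [z yz lz] := IH (Ordinal (nbump_lt l k)).
exists z => //; apply: (@RedStep (expand k) (Ordinal (nbump_lt k l))).
by rewrite -expand_comm.
Qed.

Lemma red_confl x y z : red x y -> red x z -> exists2 w, red y w & red z w.
Proof.
move=> xy; elim: xy z => [{}x|{}x k {}y _ IH] z xz; first by exists z; [|constructor].
have [w zw kw] := red_strip k xz.
have [v yv wv] := IH _ kw; exists v => //; exact: red_trans zw wv.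
Qed.

Lemma Fbr_eq_red x y : Fbr_eq x y <-> exists2 z, red x z & red y z.
Proof.
split=> [|[z /red_eq xz /red_eq yz]]; last first.
  by apply: rst_trans xz _; apply: rst_sym.
elim=> {x y}[x _ [k ->]|x|x y _ [z]|x y z _ [v xv yv] _ [w yw zw]].
- by exists (expand k); [apply: red_step|apply: RedRefl].
- by exists x; apply: RedRefl.
- by exists z.
- have [u vu wu] := red_confl yv yw.
  by exists u; [apply: red_trans xv _|apply: red_trans zw _].
Qed.

Lemma red_exists x R : tle (rtree x) R -> exists2 y, red x y & rtree y = R.
Proof.
have [m] := ubnP (leaves R - strands x).
elim: m x => // m IH x le xR; case: (tle_ext xR) => [xE|[k kx kR]].
  by exists x; [apply: RedRefl|].
have kx' : (k < strands x)%N by rewrite -(eqP (rtree_leaves x)).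
have := tle_leaves kR; rewrite leaves_add_caret => lk.
have [|//|y ky yE] := IH (@expand x (Ordinal kx')).
  by rewrite /=; have /eqP := rtree_leaves x; lia.
by exists y => //; apply: RedStep ky.
Qed.

Lemma red_unique x y z : red x y -> red x z -> rtree y = rtree z -> y = z.
Proof.
have [m] := ubnP (strands y - strands x).
elim: m x y z => // m IH x y z le xy xz yz.
have syz : strands y = strands z.
  by rewrite -(eqP (rtree_leaves y)) yz (eqP (rtree_leaves z)).
case: xy le yz syz => [_ yz syz|k {}y ky].
  by case: (red_strands xz) => //; lia.
case: xz => [_ yz syz|l {}z lz le yz syz].
  by case: (red_strands (RedStep ky)) => [<- //|]; lia.
have lek : (strands y - (strands x).+1 < m)%N.
  have : ((strands x).+1 <= strands y)%N.
    by case: (red_strands ky) => [<- //|/= /ltnW].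
  by clear -le; lia.
have [kl|kl] := eqVneq k l; first by apply: (IH (expand k)) => //; rewrite kl.
have kT : (k < leaves (rtree x))%N by rewrite (eqP (rtree_leaves x)).
have lT : (l < leaves (rtree x))%N by rewrite (eqP (rtree_leaves x)).
have := tle_caret2 kl kT lT (red_tle ky); rewrite yz => /(_ (red_tle lz)) h.
have [w] := @red_exists (@expand (expand l) (Ordinal (nbump_lt l k))) _ h.
move=> lw wz; have kw := lw; rewrite expand_comm // in kw.
have sw : strands w = strands y.
  by rewrite -(eqP (rtree_leaves w)) wz -yz (eqP (rtree_leaves y)).
transitivity w.
  apply: (IH (expand k)) => //; [exact: RedStep kw|by rewrite yz wz].
apply: (IH (expand l)) => //; [by rewrite sw|exact: RedStep lw].
Qed.

Lemma tinvK : involutive tinv.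
Proof. by case=> n T p S hT hS; rewrite /tinv /= invgK. Qed.

Lemma tinv_expand x (k : 'I_(strands x)) :
  tinv (expand k) = @expand (tinv x) k.
Proof. by rewrite /tinv /expand /=; apply: triple_eq; rewrite kappaV. Qed.

Lemma red_tinv x y : red x y -> red (tinv x) (tinv y).
Proof.
elim=> [{}x|{}x k {}y _]; first exact: RedRefl.
by rewrite tinv_expand; apply: RedStep.
Qed.

Lemma red_existsl x R : tle (ltree x) R -> exists2 y, red x y & ltree y = R.
Proof.
case/(@red_exists (tinv x)) => y /red_tinv; rewrite tinvK => xy yE.
by exists (tinv y).
Qed.

Lemma red_uniquel x y z : red x y -> red x z -> ltree y = ltree z -> y = z.
Proof.
move=> /red_tinv xy /red_tinv xz yz.
by rewrite -(tinvK y) (red_unique xy xz yz) tinvK.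
Qed.

Lemma stacked_trees x y z : stacked x y z -> rtree x = ltree y.
Proof. by case. Qed.

Lemma stacked_fun x y z z' : stacked x y z -> stacked x y z' -> z = z'.
Proof.
case=> n T S U p q hT hS hU.
move: (erefl (Triple p hT hS)) (erefl (Triple q hS hU)).
move: {1 3}(Triple p hT hS) {1 3}(Triple q hS hU) => x' y' ex ey st.
case: st ex ey => n' T' S' U' p' q' hT' hS' hU' ex ey.
have en : n' = n by case: ex.
move: p' q' hT' hS' hU' ex ey; rewrite {}en => p' q' hT' hS' hU'.
case=> eT ep eS [_ eq eU]; rewrite {}eT {}eU in hT' hU' *.
have nd := (@eq_comparable nat).
rewrite -(Eqdep_dec.inj_pair2_eq_dec _ nd _ _ _ _ ep).
rewrite -(Eqdep_dec.inj_pair2_eq_dec _ nd _ _ _ _ eq).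
exact: triple_eq.
Qed.

Lemma stacked_ex x y : rtree x = ltree y -> exists z, stacked x y z.
Proof.
case: x y => n T p S hT hS [m S' q U hS' hU] /= E.
have nm : m = n by rewrite -(eqP hS') -E (eqP hS).
move: q hS' hU; rewrite {}nm -{}E => q hS' hU.
exists (Triple (p * q) hT hU); rewrite (eq_irrelevance hS' hS).
exact: Stacked.
Qed.

Lemma stacked_redl x y z x' : stacked x y z -> red x x' ->
  exists y' z', [/\ red y y', red z z' & stacked x' y' z'].
Proof.
move=> st xx; elim: xx y z st => [{}x|{}x k {}x' _ IH] y z st.
  by exists y, z; split=> //; apply: RedRefl.
case: st k IH => n T S U p q hT hS hU k IH.
pose y1 := @expand (Triple q hS hU) k.
pose z1 := @expand (Triple (p * q) hT hU) k.
have st1 : stacked (@expand (Triple p hT hS) k) y1 z1.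
  by rewrite /z1 /expand /= kappaM; apply: Stacked.
have [y' [z' [yy zz st']]] := IH _ _ st1.
by exists y', z'; split=> //; [apply: RedStep yy|apply: RedStep zz].
Qed.

Lemma stacked_tinv x y z : stacked x y z -> stacked (tinv y) (tinv x) (tinv z).
Proof. by case=> n T S U p q hT hS hU; rewrite /tinv /= invgM; apply: Stacked. Qed.

Lemma stacked_redr x y z y' : stacked x y z -> red y y' ->
  exists x' z', [/\ red x x', red z z' & stacked x' y' z'].
Proof.
move=> /stacked_tinv st /red_tinv yy.
have [x' [z' [xx zz st']]] := stacked_redl st yy.
exists (tinv x'), (tinv z'); split.
- by rewrite -(tinvK x); apply: red_tinv.
- by rewrite -(tinvK z); apply: red_tinv.
- by rewrite -(tinvK y'); apply: stacked_tinv.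
Qed.

Lemma Fbr_eqW x y : Fbr_eq x y -> Fbr_class x = Fbr_class y.
Proof. by move/Fbr_classP. Qed.

Lemma red_class x y : red x y -> Fbr_class x = Fbr_class y.
Proof. by move=> /red_eq/Fbr_eqW. Qed.

Lemma stacked_congr x y z x' y' z' :
  stacked x y z -> stacked x' y' z' -> Fbr_class x = Fbr_class x' ->
  Fbr_class y = Fbr_class y' -> Fbr_class z = Fbr_class z'.
Proof.
move=> st st' /Fbr_classP/Fbr_eq_red[a xa x'a] /Fbr_classP/Fbr_eq_red[b yb y'b].
pose R := tjoin (rtree a) (ltree b).
have [a1 aa1 a1R] := red_exists (tle_joinl (rtree a) (ltree b)).
have [b1 bb1 b1R] := red_existsl (tle_joinr (rtree a) (ltree b)).
have key u v w : stacked u v w -> red u a -> red v b ->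
    exists2 c, red w c & stacked a1 b1 c.
  move=> suv ua vb.
  have [v' [w' [vv ww s']]] := stacked_redl suv (red_trans ua aa1).
  exists w' => //; suff <- : v' = b1 by [].
  apply: (red_uniquel vv (red_trans vb bb1)).
  by rewrite -(stacked_trees s') a1R b1R.
have [c zc sc] := key _ _ _ st xa yb.
have [c' z'c' sc'] := key _ _ _ st' x'a y'b.
by rewrite (red_class zc) (red_class z'c') (stacked_fun sc sc').
Qed.

Lemma stack_exists (X Y : Fbr) : exists x y z,
  [/\ stacked x y z, X = Fbr_class x & Y = Fbr_class y].
Proof.
have [a xa aR] := red_exists (tle_joinl (rtree (repr X)) (ltree (repr Y))).
have [b yb bR] := red_existsl (tle_joinr (rtree (repr X)) (ltree (repr Y))).
have [|c st] := @stacked_ex a b; first by rewrite aR bR.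
exists a, b, c; split=> //.
  by rewrite -(red_class xa) Fbr_classK.
by rewrite -(red_class yb) Fbr_classK.
Qed.

Lemma Fbr_mul_class x y z : stacked x y z ->
  Fbr_mul (Fbr_class x) (Fbr_class y) = Fbr_class z.
Proof.
move=> st; apply: xget_unique; first exact: (FbrProduct st).
move=> Z prod; have [x' [y' [z' [st' ex ey ->]]]] : exists x' y' z',
    [/\ stacked x' y' z', Fbr_class x = Fbr_class x',
        Fbr_class y = Fbr_class y' & Z = Fbr_class z'].
  by case: prod => x' y' z' st'; exists x', y', z'.
exact: stacked_congr st' st (esym ex) (esym ey).
Qed.

Lemma Fbr_mulA : associative Fbr_mul.
Proof.
move=> X Y Z; have [x [y [xy [st -> ->]]]] := stack_exists X Y.
rewrite -(Fbr_classK Z); move: (repr Z) => z.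
have [b yb bR] := red_exists (tle_joinl (rtree y) (ltree z)).
have [c zc cR] := red_existsl (tle_joinr (rtree y) (ltree z)).
have [a [ab [xa _ sab]]] := stacked_redr st yb.
rewrite (red_class xa) (red_class yb) (red_class zc).
have bc : rtree b = ltree c by rewrite bR cR.
case: sab bc => n T S U p q hT hS hU.
case: c {zc cR} => m U' r V hU' hV /= E.
have nm : m = n by rewrite -(eqP hU') -E (eqP hU).
move: r hU' hV; rewrite {}nm -{}E => r hU' hV.
rewrite (eq_irrelevance hU' hU).
rewrite (Fbr_mul_class (Stacked q r hS hU hV)).
rewrite (Fbr_mul_class (Stacked p q hT hS hU)).
rewrite (Fbr_mul_class (Stacked p (q * r) hT hS hV)).
by rewrite (Fbr_mul_class (Stacked (p * q) r hT hU hV)) mulgA.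
Qed.

Lemma Fbr_oneE n T (h h' : leaves T == n) : Fbr_class (Triple 1 h h') = Fbr_one.
Proof.
pose diag x := exists m S (g g' : leaves S == m), x = Triple 1 g g'.
have diag_red x y : red x y -> diag x -> diag y.
  elim=> // {}x k {}y _ IH [m [S [g [g' E]]]]; apply: IH.
  move: k; rewrite E => k; exists m.+1, (add_caret S k).
  exists (expand_leaves k g), (expand_leaves k g').
  by rewrite /expand /= kappa1.
rewrite /Fbr_one; set e := Triple (1 : PB 1) _ _.
have [y ey yT] := @red_exists e T isT.
have [|m [S [g [g' E]]]] := diag_red _ _ ey.
  by exists 1%N, Leaf, (eqxx _), (eqxx _).
rewrite (red_class ey) E; move: yT; rewrite E /= => ST.
clear ey E; move: g g'; rewrite ST => g g'.
have nm : m = n by rewrite -(eqP g) (eqP h).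
move: g g'; rewrite nm => g g'; congr Fbr_class; exact: triple_eq.
Qed.

Lemma Fbr_mul1 : left_id Fbr_one Fbr_mul.
Proof.
move=> X; rewrite -(Fbr_classK X); case: (repr X) => n T p S hT hS.
by rewrite -(Fbr_oneE hT hT) (Fbr_mul_class (Stacked 1 p hT hT hS)) mul1g.
Qed.

Lemma Fbr_mulr1 : right_id Fbr_one Fbr_mul.
Proof.
move=> X; rewrite -(Fbr_classK X); case: (repr X) => n T p S hT hS.
by rewrite -(Fbr_oneE hS hS) (Fbr_mul_class (Stacked p 1 hT hS hS)) mulg1.
Qed.

Lemma Fbr_mulV : left_inverse Fbr_one Fbr_inv Fbr_mul.
Proof.
move=> X; rewrite -{2}(Fbr_classK X) /Fbr_inv; case: (repr X) => n T p S hT hS.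
by rewrite (Fbr_mul_class (Stacked p^-1 p hS hT hS)) mulVg Fbr_oneE.
Qed.

Lemma Fbr_mulrV : right_inverse Fbr_one Fbr_inv Fbr_mul.
Proof.
move=> X; rewrite -{1}(Fbr_classK X) /Fbr_inv; case: (repr X) => n T p S hT hS.
by rewrite (Fbr_mul_class (Stacked p p^-1 hT hS hT)) mulgV Fbr_oneE.
Qed.

HB.instance Definition _ :=
  isGroup.Build Fbr Fbr_mulA Fbr_mul1 Fbr_mulr1 Fbr_mulV Fbr_mulrV.

Lemma FbrM n T S U (p q : PB n) (hT : leaves T == n) (hS : leaves S == n)
    (hU : leaves U == n) :
  Fbr_class (Triple p hT hS) * Fbr_class (Triple q hS hU) =
  Fbr_class (Triple (p * q) hT hU).
Proof. exact/Fbr_mul_class/Stacked. Qed.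

Definition subgroup_closed (G : groupType) (H : set G) : Prop :=
  H 1 /\ forall x y : G, H x -> H y -> H (x * y^-1).

Definition commutator_subgroup (G : groupType) (H K : set G) : set G :=
  smallest (@subgroup_closed G)
    [set z | exists x y : G, [/\ H x, K y & z = [~ x, y]]].

Definition perfect (G : groupType) (H : set G) : Prop :=
  commutator_subgroup H H = H.

(* Main.v *)
From HB Require Import structures.
Require Import Defs.
From mathcomp Require Import all_boot all_fingroup generic_quotient zify.
From mathcomp Require Import boolp classical_sets.

(** Write G for [Fbr]. That G' is perfect follows once G/G'' is shown to be
    commutative, for then G' is contained in G''.

    Everything is computed in the image of G under a morphism f to a quotient.
    Two families of elements together generate G: the tree pairs (T, 1, S),
    which form a copy of Thompson's group F, and the pure elements (T, p, T).

    Thompson's group is generated by slides (S + caret at k, 1, S + caret at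
    k.+1). Adding a caret to S on a leaf other than k and k.+1 does not change
    a slide, while adding it on one of these two leaves writes the slide as a
    product of two slides. Call a slide interior when it fixes the first and
    the last leaf. If the images of the interior slides commute with each
    other, then in the product formula for an interior slide all three slides
    have the same image y, because they are conjugate by products of interior
    slides. So y = y * y and y = 1 ([interior_slide_trivial]). This applies to
    G/G', so interior slides lie in G'; hence their images in G/G'' commute,
    and it applies to G/G'' as well ([interior_slide_second_derived]).

    From now on f kills the interior slides. The image of a slide at the first
    leaf is then the same element a for all trees with at least three leaves,
    and likewise b at the last leaf; a and b commute and generate the image of
    F. A pure element (T, p, T) commutes with every slide that takes place
    below a single leaf of T, because cloning a strand of p twice does not
    depend on which of the two copies is cloned the second time
    ([pure_elt_slide]). Taking the first and the last leaf of T, it commutes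
    with a and b, so the image of F is central. In particular the image of
    (T, p, T), being unchanged by conjugation by tree pairs, depends on p only. It
    defines morphisms x_n on the groups PB_n with x_(n+1) (kappa_k p) = x_n p
    for all k.

    It remains to see that such a family always has commuting values
    ([cloning_invariant_commute]). PB_n is generated by the band generators
    A_(i,j) ([pure_braid_ind]). Cloning a strand other than i and j preserves
    the shape of A_(i,j), so its value depends only on which of the three gaps
    (left of i, between i and j, right of j) are empty; cloning the strand i
    or j expresses A_(i,j) as a product of two band generators. By these
    relations all values are products of two of them, which commute since they
    are taken on the nested, unlinked bands A_(0,3) and A_(1,2) of PB_4. *)

Set Implicit Arguments.
Unset Strict Implicit.
Unset Printing Implicit Defensive.

Local Open Scope classical_set_scope.
Local Open Scope group_scope.

(** * Subgroups and quotients *)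

Section Subgroups.
Variables (G : groupType) (H : set G).
Hypothesis H_closed : subgroup_closed H.

Lemma subgroup_inv x : H x -> H x^-1.
Proof. by move=> Hx; have := H_closed.2 _ _ H_closed.1 Hx; rewrite mul1g. Qed.

Lemma subgroup_mul x y : H x -> H y -> H (x * y).
Proof.
by move=> Hx /subgroup_inv Hy; have := H_closed.2 _ _ Hx Hy; rewrite invgK.
Qed.

Lemma subgroup_conj x y : H x -> H y -> H (x ^ y).
Proof.
by move=> Hx Hy; do !apply: subgroup_mul => //; apply: subgroup_inv.
Qed.

End Subgroups.

Definition generated (G : groupType) (S : set G) : set G :=
  smallest (@subgroup_closed G) S.

Lemma generated_closed (G : groupType) (S : set G) :
  subgroup_closed (generated S).
Proof.
split=> [H [[H1 _] _]//|x y Sx Sy H HS].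
by apply: HS.1.2; [apply: Sx|apply: Sy].
Qed.

Lemma centraliser_closed (G : groupType) (y : G) :
  subgroup_closed [set x | commute x y].
Proof.
split=> [|x z /= xy zy]; first exact/commute_sym/commute1.
by apply/commute_sym/commuteM; [|apply: commuteV]; apply: commute_sym.
Qed.

Lemma generated_conj (G : groupType) (S : set G) (y : G) :
  (forall x, S x -> generated S (x ^ y)) ->
  forall x, generated S x -> generated S (x ^ y).
Proof.
move=> Sy; apply: (@smallest_sub _ _ _ [set x | generated S (x ^ y)]) => //.
have [S1 SF] := generated_closed S.
split=> [|x z /= Sx Sz]; first by rewrite /= conj1g.
by rewrite conjMg conjVg; apply: SF.
Qed.

Lemma commutator_conj (G : groupType) (H K : set G) (y : G) :
  (forall x, H x -> H (x ^ y)) -> (forall x, K x -> K (x ^ y)) ->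
  forall x, commutator_subgroup H K x -> commutator_subgroup H K (x ^ y).
Proof.
move=> Hy Ky; apply: generated_conj => _ [a [b [Ha Kb ->]]].
apply: sub_gen_smallest; exists (a ^ y), (b ^ y).
by split; [apply: Hy|apply: Ky|apply: conjRg].
Qed.

(** For sets of products such as cosets, which are stable under multiplication
    by the generators on one side only. *)
Lemma generated_rind (G : groupType) (S K : set G) :
  K 1 -> (forall x y, K x -> S y -> K (x * y) /\ K (x * y^-1)) ->
  generated S `<=` K.
Proof.
move=> K1 KS.
have h : generated S `<=`
    [set y | forall x, K x -> K (x * y) /\ K (x * y^-1)].
  apply: smallest_sub; last by move=> y Sy x Kx; apply: KS.
  split=> [x Kx|y z Hy Hz x Kx]; first by rewrite invg1 mulg1.
  rewrite invgM invgK !mulgA; split; first exact: (Hz _ (Hy _ Kx).1).2.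
  exact: (Hy _ (Hz _ Kx).1).2.
by move=> y /h/(_ _ K1)[]; rewrite mul1g.
Qed.

Lemma commutator_closed (G : groupType) (H : set G) : subgroup_closed H ->
  commutator_subgroup H H `<=` H.
Proof.
move=> Hc; apply: smallest_sub => // _ [x [y [Hx Hy ->]]].
rewrite /commg; apply: (subgroup_mul Hc); first exact: (subgroup_inv Hc).
exact: (subgroup_conj Hc).
Qed.

Lemma commutator_in (G : groupType) (H K : set G) x y :
  H x -> K y -> commutator_subgroup H K [~ x, y].
Proof. by move=> Hx Ky; apply: sub_gen_smallest; exists x, y. Qed.

(** Bundled, so that the type of cosets below can depend on it and still be
    given a canonical group structure. *)
Record normal_subgroup (G : groupType) := NormalSubgroup {
  nset :> G -> Prop;
  nset_closed : @subgroup_closed G nset;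
  nset_conj : forall x y, nset x -> nset (x ^ y)
}.

Section Quotient.
Variables (G : groupType) (N : normal_subgroup G).

Let N1 : N 1 := (nset_closed N).1.
Let NM := subgroup_mul (nset_closed N).
Let NV := subgroup_inv (nset_closed N).

Definition same_coset : rel G := fun x y => `[< N (x * y^-1) >].

Lemma same_coset_refl : reflexive same_coset.
Proof. by move=> x; apply/asboolP; rewrite mulgV. Qed.

Lemma same_coset_sym : symmetric same_coset.
Proof.
by move=> x y; apply/asboolP/asboolP => /NV; rewrite invgM invgK.
Qed.

Lemma same_coset_trans : transitive same_coset.
Proof.
move=> y x z /asboolP xy /asboolP yz; apply/asboolP.
by have := NM xy yz; rewrite mulgA mulgVK.
Qed.

Canonical same_coset_equiv :=
  EquivRel same_coset same_coset_refl same_coset_sym same_coset_trans.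

Definition quotient_group : Type := {eq_quot same_coset}%qT.
HB.instance Definition _ := Choice.on quotient_group.
HB.instance Definition _ := Quotient.on quotient_group.

Definition coset (x : G) : quotient_group := (\pi_quotient_group x)%qT.

Lemma coset_eq x y : coset x = coset y <-> N (x * y^-1).
Proof. by split=> [/eqmodP/asboolP|xy] //; apply/eqmodP/asboolP. Qed.

Lemma coset_repr (X : quotient_group) : coset (repr X) = X.
Proof. exact: reprK. Qed.

Lemma coset_mul_eq x x' y y' :
  coset x = coset x' -> coset y = coset y' -> coset (x * y) = coset (x' * y').
Proof.
move=> /coset_eq xx /coset_eq yy; apply/coset_eq.
have := NM (nset_conj x^-1 yy) xx.
by rewrite /conjg !invgM invgK !mulgA mulgVK.
Qed.

Definition quotient_mul (X Y : quotient_group) := coset (repr X * repr Y).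
Definition quotient_inv (X : quotient_group) := coset (repr X)^-1.

Lemma cosetM_subproof x y : quotient_mul (coset x) (coset y) = coset (x * y).
Proof. by apply: coset_mul_eq; apply: coset_repr. Qed.

Lemma quotient_mulA : associative quotient_mul.
Proof.
move=> X Y Z; rewrite -(coset_repr X) -(coset_repr Y) -(coset_repr Z).
by rewrite !cosetM_subproof mulgA.
Qed.

Lemma quotient_mul1 : left_id (coset 1) quotient_mul.
Proof. by move=> X; rewrite -(coset_repr X) cosetM_subproof mul1g. Qed.

Lemma quotient_mulr1 : right_id (coset 1) quotient_mul.
Proof. by move=> X; rewrite -(coset_repr X) cosetM_subproof mulg1. Qed.

Lemma quotient_mulV : left_inverse (coset 1) quotient_inv quotient_mul.
Proof.
by move=> X; rewrite -{2}(coset_repr X) cosetM_subproof mulVg.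
Qed.

Lemma quotient_mulrV : right_inverse (coset 1) quotient_inv quotient_mul.
Proof.
by move=> X; rewrite -{1}(coset_repr X) cosetM_subproof mulgV.
Qed.

HB.instance Definition _ :=
  isGroup.Build quotient_group quotient_mulA quotient_mul1 quotient_mulr1
    quotient_mulV quotient_mulrV.

Lemma cosetM : {morph coset : x y / x * y}.
Proof. by move=> x y; rewrite -cosetM_subproof. Qed.

Lemma coset_eq1 x : coset x = 1 <-> N x.
Proof. by rewrite (coset_eq x 1) invg1 mulg1. Qed.

End Quotient.

(** The way in which all trivial values below are detected: a relation among
    generators turns out to read y = y * y. *)
Lemma idempotent_trivial (Q : groupType) (y : Q) : y = y * y -> y = 1.
Proof. by move=> E; apply: (mulgI y); rewrite -E mulg1. Qed.

Section Morphism.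
Variables (G Q : groupType) (f : G -> Q).
Hypothesis fM : {morph f : x y / x * y}.

Lemma morph1 : f 1 = 1.
Proof. by apply: (mulgI (f 1)); rewrite -fM !mulg1. Qed.

Lemma morphV : {morph f : x / x^-1}.
Proof. by move=> x; apply: (mulgI (f x)); rewrite -fM !mulgV morph1. Qed.

Lemma preim_closed (K : set Q) :
  subgroup_closed K -> subgroup_closed (f @^-1` K).
Proof.
move=> [K1 KF]; split=> [|x y Kx Ky]; rewrite /= ?morph1 //.
by rewrite fM morphV; apply: KF.
Qed.
End Morphism.

Lemma commutator_sub_normal (G : groupType) (N : normal_subgroup G) :
  (forall x y : G, commute (coset N x) (coset N y)) ->
  commutator_subgroup [set: G] [set: G] `<=` nset N.
Proof.
move=> ab; apply: smallest_sub; first exact: nset_closed.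
move=> _ [x [y [_ _ ->]]]; apply/coset_eq1.
apply: (mulgI (coset N (y * x))).
by rewrite -cosetM -commgC mulg1 !cosetM; apply: ab.
Qed.

Lemma coset_commute (G : groupType) (N : normal_subgroup G) (x y : G) :
  N [~ x, y] -> commute (coset N x) (coset N y).
Proof.
by move=> /coset_eq1 E; rewrite /commute -!cosetM commgC cosetM E mulg1.
Qed.

Definition derived (G : groupType) : normal_subgroup G.
Proof.
exists (commutator_subgroup [set: G] [set: G]); first exact: generated_closed.
by move=> x y; apply: commutator_conj.
Defined.

Definition second_derived (G : groupType) : normal_subgroup G.
Proof.
exists (commutator_subgroup (derived G) (derived G)).
  exact: generated_closed.
by move=> x y; apply: commutator_conj => z; apply: nset_conj.
Defined.

(** * Generation of pure braid groups by band generators *)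

(** sigma_(j+d-1) ... sigma_j: moves the strand at position j + d in front of
    the d strands to its left, down to position j. *)
Fixpoint desc_word (j d : nat) : seq (nat * bool) :=
  if d is d'.+1 then ((j + d')%N, false) :: desc_word j d' else [::].

Definition desc n j d : braid n := neval n (desc_word j d).

(** The standard generator A_(j,m) of the pure braid group with m = j + d + 1:
    strand m travels next to strand j, winds once around it and travels back.
    The parameter [d] counts the strands strictly between the two. *)
Definition band n j d : braid n :=
  (gen n j * gen n j) ^ (desc n j.+1 d)^-1.

Section Words.
Variable n : nat.
Local Notation s := (gen n).
Local Notation D := (desc n).
Local Notation A := (band n).

Lemma bandE j d : A j d = D j.+1 d * (s j * s j) * (D j.+1 d)^-1.
Proof. by rewrite /band /conjg invgK !mulgA. Qed.

Lemma desc0 j : D j 0 = 1.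
Proof. exact: neval_nil. Qed.

Lemma descS j d : D j d.+1 = s (j + d) * D j d.
Proof. by rewrite /desc /= neval_cons. Qed.

Lemma desc_rcons j d : D j d.+1 = D j.+1 d * s j.
Proof.
elim: d => [|d IH]; first by rewrite descS !desc0 mul1g mulg1 addn0.
by rewrite descS IH mulgA addnS -addSn -descS.
Qed.

Lemma desc_comm_above j d k : (k.+1 < j)%N -> commute (s k) (D j d).
Proof.
move=> kj; elim: d => [|d IH]; first by rewrite desc0; apply: commute1.
by rewrite descS; apply: commuteM => //; apply: gen_far; lia.
Qed.

Lemma desc_comm_below j d k : (j + d < k)%N -> commute (s k) (D j d).
Proof.
elim: d => [|d IH] jk; first by rewrite desc0; apply: commute1.
rewrite descS; apply: commuteM; last by apply: IH; lia.
by apply/commute_sym/gen_far; lia.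
Qed.

Lemma desc_shift j d k : (j <= k)%N -> (k.+1 < j + d)%N -> (j + d < n)%N ->
  s k * D j d = D j d * s k.+1.
Proof.
elim: d => [|d IH] jk kd dn; first by lia.
rewrite descS; have [E|lt] : (k.+1 = j + d \/ k.+1 < j + d)%N by lia.
  case: d E {IH} kd dn => [|d] E kd dn; first by lia.
  have -> : (j + d.+1 = k.+1)%N by lia.
  rewrite descS; have -> : (j + d = k)%N by lia.
  have C : commute (s k.+1) (D j d) by apply: desc_comm_below; lia.
  by rewrite !mulgA -(mulgA _ _ (s k)) gen_braid -?mulgA ?C //; lia.
rewrite mulgA (@gen_far n k (j + d)) // -!mulgA; congr (_ * _).
by apply: IH; lia.
Qed.

(** The crossing of the strands k and k.+1 takes place away from the band, or
    entirely between the two strands that it links. *)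
Lemma band_far j d k : (k.+1 < j)%N \/ (j < k < j + d)%N -> (j + d.+1 < n)%N ->
  commute (s k) (A j d).
Proof.
move=> hk dn; have [x [E C]] : exists x,
    s k * D j.+1 d = D j.+1 d * x /\ commute x (s j).
  case: hk => [kj|/andP[jk kd]].
    exists (s k); split; first by apply: desc_comm_above; lia.
    exact: gen_far.
  by exists (s k.+1); split; [apply: desc_shift|apply/commute_sym/gen_far]; lia.
have {}C : commute x (s j * s j) by apply: commuteM.
have -> : s k = x ^ (D j.+1 d)^-1 by rewrite /conjg invgK mulgA -E mulgK.
by rewrite /commute -!conjMg C.
Qed.

Lemma gen_braidx j x : (j.+2 < n)%N ->
  s j * (s j.+1 * (s j * x)) = s j.+1 * (s j * (s j.+1 * x)).
Proof. by move=> /gen_braid/(congr1 (mulg^~ x)); rewrite -!mulgA. Qed.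

Lemma gen_conj_sq j : (j.+2 < n)%N ->
  (s j * s j) ^ (s j.+1)^-1 = (s j.+1 * s j.+1) ^ s j.
Proof.
move=> jn; rewrite /conjg invgK; apply: (mulgI (s j)); apply: (mulIg (s j.+1)).
by rewrite -!mulgA mulVg mulg1 mulVKg gen_braidx // -gen_braid.
Qed.

(** The four lemmas below give the conjugates of A_(j,m) and A_(j+1,m) by
    sigma_j and its inverse: two of them are band generators with the same m,
    the other two are conjugates of such by a band generator with that m. *)
Lemma band_pred j d : (j.+1 + d.+1 < n)%N -> A j.+1 d ^ s j = A j d.+1.
Proof.
move=> dn; have C : commute (s j) (D j.+2 d)^-1.
  exact/commuteV/desc_comm_above.
by rewrite /band desc_rcons invgM conjgM gen_conj_sq -?conjgM ?C //; lia.
Qed.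

Lemma band_succ j d : (j.+1 + d.+1 < n)%N -> A j d.+1 ^ (s j)^-1 = A j.+1 d.
Proof. by move=> dn; rewrite -band_pred // conjgK. Qed.

Lemma band_predV j d : (j.+1 + d.+1 < n)%N ->
  A j.+1 d ^ (s j)^-1 = A j d.+1 ^ A j.+1 d.
Proof.
move=> dn; have jn : (j.+2 < n)%N by lia.
have C : commute (s j) (D j.+2 d)^-1.
  exact/commuteV/desc_comm_above.
have -> : A j d.+1 = ((s j * s j) ^ (s j.+1)^-1) ^ (D j.+2 d)^-1.
  by rewrite /band desc_rcons invgM conjgM.
have CV : (D j.+2 d)^-1 * (s j)^-1 = (s j)^-1 * (D j.+2 d)^-1.
  by rewrite -!invgM; congr (_^-1); apply: desc_comm_above; lia.
rewrite /band -conjJg -[LHS]conjgM CV conjgM -(conjgM _ _ (s j.+1 * s j.+1)).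
rewrite mulKg; congr (_ ^ _).
rewrite /conjg invgK; apply: (mulgI (s j.+1)); apply: (mulIg (s j)).
by rewrite -!mulgA mulVg mulg1 mulVKg gen_braid // gen_braidx.
Qed.

Lemma band_succV j d : (j.+1 + d.+1 < n)%N ->
  A j d.+1 ^ s j = A j.+1 d ^ (A j d.+1)^-1.
Proof.
move=> dn; have := congr1 (conjg^~ (s j)) (band_predV dn).
rewrite conjgKV conjJg band_pred // => ->.
by rewrite conjgK.
Qed.

(** The braids on the strands 0, ..., m; thus m is the last strand, not the
    number of strands. *)
Definition low_braid (m : nat) : set (braid n) :=
  generated [set x | exists2 k, (k < m)%N & x = s k].

Definition last_bands (m : nat) : set (braid n) :=
  generated [set x | exists j d, (j + d.+1 = m)%N /\ x = A j d].

(** What [band_far] and the four formulas above amount to: crossings on the left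
    of strand m normalise the subgroup of the bands that link strand m to the
    strands on its left. *)
Lemma last_bands_conj_gen m k x : (m < n)%N -> (k.+1 < m)%N ->
  last_bands m x -> last_bands m (x ^ s k) /\ last_bands m (x ^ (s k)^-1).
Proof.
move=> mn km.
have gA j d : (j + d.+1 = m)%N -> last_bands m (A j d).
  by move=> jd; apply: sub_gen_smallest; exists j, d.
have gJ := subgroup_conj (generated_closed _).
have gV := subgroup_inv (generated_closed _).
have key j d : (j + d.+1 = m)%N ->
    last_bands m (A j d ^ s k) /\ last_bands m (A j d ^ (s k)^-1).
  move=> jd.
  have [far|[jk|jk]] : ((k.+1 < j)%N \/ (j < k < j + d)%N) \/
    (j = k.+1 \/ j = k) by lia.
  - have C : commute (A j d) (s k) by apply/commute_sym/band_far => //; lia.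
    by rewrite /conjg C (commuteV C) !mulKg; split; apply: gA.
  - subst j; rewrite band_pred ?band_predV; try lia.
    by split; [|apply: gJ]; apply: gA; lia.
  - subst j; case: d jd => [|d] jd; first by lia.
    rewrite band_succ ?band_succV; try lia.
    by split; [apply: gJ; [|apply: gV]|]; apply: gA; lia.
move=> Px; split; move: x Px; apply: generated_conj => _ [j [d [jd ->]]].
  exact: (key _ _ jd).1.
exact: (key _ _ jd).2.
Qed.

Lemma last_bands_conj m h x : (m.+1 < n)%N -> low_braid m h ->
  last_bands m.+1 x -> last_bands m.+1 (x ^ h).
Proof.
move=> mn Lh; move: h Lh x.
apply: (@generated_rind _ _ [set h | forall x, last_bands m.+1 x ->
  last_bands m.+1 (x ^ h)]) => [x|h _ Hh [k km ->]]; first by rewrite conjg1.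
by split=> x /Hh Px; rewrite conjgM;
  have [] := @last_bands_conj_gen m.+1 k _ mn km Px.
Qed.

(** Coset enumeration.  The braid group on the strands 0, ..., m.+1 is covered
    by the cosets P H D, where P is the subgroup of the bands that link strand
    m.+1 to an earlier one, H the braid group on the strands 0, ..., m, and D
    one of the m + 2 words that move the strand at position m.+1 to the left.
    Right multiplication by sigma_k permutes the words D, up to a factor sigma_i
    of H, except that a square of sigma_j may appear next to D; moved across D it
    becomes a band. *)
Lemma low_braid_factor m b : (m.+1 < n)%N -> low_braid m.+1 b ->
  exists p h j d, [/\ last_bands m.+1 p, low_braid m h, (j + d = m.+1)%N &
    b = p * h * D j d].
Proof.
move=> mn; move: b.
have [L1 LF] := generated_closed [set x | exists2 k, (k < m)%N & x = s k].
have LM := subgroup_mul (conj L1 LF); have LV := subgroup_inv (conj L1 LF).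
have [P1 PF] := generated_closed
  [set x | exists j d, (j + d.+1 = m.+1)%N /\ x = A j d].
have PM := subgroup_mul (conj P1 PF); have PV := subgroup_inv (conj P1 PF).
have Lg k : (k < m)%N -> low_braid m (s k).
  by move=> km; apply: sub_gen_smallest; exists k.
have Pg j d : (j + d.+1 = m.+1)%N -> last_bands m.+1 (A j d).
  by move=> jd; apply: sub_gen_smallest; exists j, d.
pose fac : set (braid n) := [set b | exists p h j d,
  [/\ last_bands m.+1 p, low_braid m h, (j + d = m.+1)%N & b = p * h * D j d]].
have facI p h p' j d : last_bands m.+1 p -> low_braid m h ->
    last_bands m.+1 p' -> (j + d = m.+1)%N -> fac (p * h * (p' * D j d)).
  move=> Pp Lh Pp' jd; exists (p * p' ^ h^-1), h, j, d; split=> //.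
    by apply: PM => //; apply: last_bands_conj => //; apply: LV.
  by rewrite /conjg invgK !mulgA mulgVK.
have facI1 p h j d : last_bands m.+1 p -> low_braid m h ->
    (j + d = m.+1)%N -> fac (p * h * D j d).
  by exists p, h, j, d.
apply: (@generated_rind _ _ fac).
  by exists 1, 1, m.+1, 0%N; rewrite addn0 desc0 !mulg1.
move=> _ _ [p [h [j [d [Pp Lh jd ->]]]]] [k km ->]; rewrite -!(mulgA (p * h)).
have [[i [im E]]|[jk|jk]] : (exists i, (i < m)%N /\ s i * D j d = D j d * s k)
    \/ (j = k.+1 \/ j = k).
(* Away from D = D j d, sigma_k commutes with it; within its range sigma_k
   crosses D as sigma_(k-1).  The values k = j - 1 and k = j lengthen or
   shorten D. *)
- have [kj|[jk|[jk|jk]]] :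
    (k.+1 < j \/ (j < k \/ (j = k.+1 \/ j = k)))%N by lia.
  + by left; exists k; split; [lia|apply: desc_comm_above].
  + left; exists k.-1; split; first by lia.
    by rewrite desc_shift ?prednK //; lia.
  + by right; left.
  + by right; right.
- have EV : D j d * (s k)^-1 = (s i)^-1 * D j d.
    by apply: (mulIg (s k)); rewrite mulgVK -mulgA -E mulKg.
  rewrite -E EV; split; [exists p, (h * s i), j, d|exists p, (h * (s i)^-1), j, d];
    split; rewrite ?mulgA //; apply: LM => //; [|apply: LV]; exact: Lg.
- subst j; split.
    by rewrite -desc_rcons; apply: facI1 => //; lia.
  have -> : D k.+1 d * (s k)^-1 = (A k d)^-1 * D k d.+1.
    rewrite desc_rcons bandE !invgM invgK !mulgA; apply: (mulIg (s k)).
    by rewrite !mulgVK.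
  apply: facI => //; last lia.
  by apply: PV; apply: Pg; lia.
- subst j; case: d jd => [|d] jd; first by lia.
  rewrite desc_rcons mulgK; split; last first.
    by apply: facI1 => //; lia.
  have -> : D k.+1 d * s k * s k = A k d * D k.+1 d.
    by rewrite bandE !mulgA mulgVK.
  apply: facI => //; last lia.
  by apply: Pg; lia.
Qed.

Lemma gen_perm i (k : 'I_n) : (i < n.-1)%N ->
  braid_perm (s i) k = nswap i k :> nat.
Proof.
move=> lt; rewrite gen_lt braid_perm_cls word_perm_cons word_perm_nil mulg1.
exact: letter_permE.
Qed.

Lemma pure_subgroup : subgroup_closed [set b : braid n | pure b].
Proof.
have [p1 pF] := pure_closed n; split=> [|x y px py]; first exact: p1.
exact: pF.
Qed.

Lemma pure_conj (x y : braid n) : pure x -> pure (x ^ y).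
Proof.
rewrite /pure => /eqP px.
by rewrite /conjg !braid_permM braid_permV px mul1g mulVg.
Qed.

Lemma pure_gen_sq j : pure (s j * s j).
Proof.
rewrite /pure braid_permM; have [lt|out] := ltnP j n.-1; last first.
  by rewrite gen_out // braid_perm1 mulg1.
rewrite gen_lt braid_perm_cls word_perm_cons word_perm_nil mulg1.
by rewrite /letter_perm tperm2.
Qed.

Lemma pure_band j d : pure (A j d).
Proof. exact/pure_conj/pure_gen_sq. Qed.

Lemma desc_perm j d (k : 'I_n) : k = (j + d)%N :> nat ->
  braid_perm (D j d) k = j :> nat.
Proof.
elim: d k => [|d IH] k kE; first by rewrite desc0 braid_perm1 perm1 kE addn0.
rewrite descS braid_permM permM; apply: IH.
have lt := ltn_ord k.
by rewrite gen_perm /nswap; last lia; do !case: eqP; lia.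
Qed.

Lemma low_braid_perm m b (k : 'I_n) : (m < k)%N -> low_braid m b ->
  braid_perm b k = k.
Proof.
move=> mk; move: b; apply: smallest_sub.
  split=> [|x y xk yk]; first by rewrite /= braid_perm1 perm1.
  by rewrite /= braid_permM braid_permV permM xk -{1}yk permK.
move=> _ [i im ->]; apply: val_inj; have lt := ltn_ord k.
by rewrite /= gen_perm /nswap; last lia; do !case: eqP; lia.
Qed.

(** In the factorisation p h D of a pure braid, p is pure and h fixes the last
    position, so D has to fix it as well and is trivial: what remains is the
    pure braid h on one strand less. *)
Lemma pure_low_braid_ind (K : set (braid n)) m b : subgroup_closed K ->
  (forall j d, (j + d.+1 < n)%N -> K (A j d)) ->
  (m < n)%N -> low_braid m b -> pure b -> K b.
Proof.
move=> Kc KA; elim: m b => [|m IH] b mn Lb pb.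
  suff -> : b = 1 by apply: Kc.1.
  move: b Lb {pb}; apply: smallest_sub => [|_ [k]//].
  by split=> // x y /= -> ->; rewrite invg1 mulg1.
have [p [h [j [d [Pp Lh jd E]]]]] := low_braid_factor mn Lb.
have pp : pure p.
  move: p Pp {E}; apply: smallest_sub; first exact: pure_subgroup.
  by move=> _ [i [e [_ ->]]]; apply: pure_band.
have Kp : K p.
  move: p Pp {E pp}; apply: smallest_sub => // _ [i [e [ie ->]]].
  by apply: KA; lia.
have jE : j = m.+1.
  move/eqP: pb; rewrite E !braid_permM (eqP pp) mul1g.
  move=> /permP/(_ (Ordinal mn)); rewrite permM perm1.
  rewrite (low_braid_perm _ Lh) //= => /(congr1 val) /=.
  by rewrite desc_perm //= jd.
have d0 : d = 0%N by lia.
subst d j; rewrite desc0 mulg1 in E; rewrite E in pb *.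
apply: (subgroup_mul Kc) => //; apply: IH => //; first lia.
have -> : h = p^-1 * (p * h) by rewrite mulKg.
by apply: (subgroup_mul pure_subgroup) => //; apply: (subgroup_inv pure_subgroup).
Qed.

Lemma low_braidT b : low_braid n.-1 b.
Proof.
have Lc := generated_closed [set x | exists2 k, (k < n.-1)%N & x = s k].
rewrite -(clsK b); elim: (repr b) => [|[i e] w IH]; first exact: Lc.1.
rewrite -cat1s cls_cat; apply: (subgroup_mul Lc) => //.
have Li : low_braid n.-1 (s i) by apply: sub_gen_smallest; exists i.
by case: e; rewrite ?cls_letterV -gen_ord //; apply: (subgroup_inv Lc).
Qed.

(** The descent starts from the full braid group, where m is the last strand. *)
Lemma pure_braid_ind (K : set (braid n)) : subgroup_closed K ->
  (forall j d, (j + d.+1 < n)%N -> K (A j d)) -> forall b, pure b -> K b.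
Proof.
move=> Kc KA b pb; have [n0|n0] := posnP n; last first.
  by apply: (pure_low_braid_ind Kc KA _ (low_braidT b)) => //; lia.
suff -> : b = 1 by apply: Kc.1.
rewrite -(clsK b); case: (repr b) => [//|[i e] w].
by have := ltn_ord i; rewrite [X in (_ < X.-1)%N]n0.
Qed.
End Words.

(** * Cloning band generators *)

(** Words with unbounded indices are cloned by [nclone], which computes; this
    lemma and the next one carry the results to braids. *)
Lemma in_range_word n (w : seq (nat * bool)) :
  all (fun l => l.1 < n.-1)%N w ->
  exists2 v : braid_word n, nword v = w & cls v = neval n w.
Proof.
elim: w => [|[i e] w IH] /=; first by exists [::]; rewrite ?cls_neval.
case/andP=> lt /IH[v <- _].
by exists ((Ordinal lt, e) :: v); rewrite ?cls_neval.
Qed.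

Lemma clone_neval n (k : 'I_n) w : all (fun l => l.1 < n.-1)%N w ->
  clone k (neval n w) = neval n.+1 (nclone k w) /\
  braid_perm (neval n w) k = nperm w k :> nat.
Proof.
case/in_range_word=> v <- <-; rewrite clone_cls braid_perm_cls.
by rewrite cls_neval nword_clone nword_perm.
Qed.

Lemma clone1 n (k : 'I_n) : clone k 1 = 1.
Proof. by rewrite -cls_nil clone_cls. Qed.

Lemma cloneV n (k : 'I_n) (x : braid n) :
  clone (braid_perm x k) x^-1 = (clone k x)^-1.
Proof. by apply: (mulgI (clone k x)); rewrite -cloneM !mulgV clone1. Qed.

Lemma clone_conjV n (k : 'I_n) (x y : braid n) : pure x ->
  clone k (x ^ y^-1) = clone (braid_perm y k) x ^ (clone k y)^-1.
Proof.
move=> /eqP px; rewrite /conjg !invgK !cloneM px perm1.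
by rewrite cloneV.
Qed.

Lemma desc_word_range n j d : (j + d < n)%N ->
  all (fun l => l.1 < n.-1)%N (desc_word j d).
Proof. by elim: d => //= d IH lt; rewrite IH ?andbT; lia. Qed.

Lemma nclone_desc_below j d k : (k < j)%N ->
  nclone k (desc_word j d) = desc_word j.+1 d /\ nperm (desc_word j d) k = k.
Proof.
move=> kj; elim: d => [//|d [IH1 IH2]]; rewrite /= -/(nclone_letter _ (_, _)).
by case: ncloneP => ?; try (exfalso; lia); rewrite IH1 IH2.
Qed.

Lemma nclone_desc_above j d k : (j + d < k)%N ->
  nclone k (desc_word j d) = desc_word j d /\ nperm (desc_word j d) k = k.
Proof.
elim: d => [//|d IH] kj; rewrite /= -/(nclone_letter _ (_, _)).
by case: ncloneP => ?; try (exfalso; lia); have [|-> ->] := IH; first lia.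
Qed.

Lemma nclone_desc_mid j d k : (j <= k < j + d)%N ->
  nclone k (desc_word j d) = desc_word j d.+1 /\
  nperm (desc_word j d) k = k.+1.
Proof.
elim: d => [|d IH] kj; first by lia.
rewrite /= -/(nclone_letter _ (_, _)).
case: ncloneP => h; try (exfalso; lia).
  have [|-> ->] := IH; first by lia.
  by rewrite addnS.
have [|-> ->] := @nclone_desc_above j d (j + d).+1; first by lia.
by rewrite h addnS.
Qed.

(** Doubling the strand that moves produces two parallel descents, interleaved
    letter by letter; here they are disentangled into one after the other. *)
Lemma nclone_desc_last n j d :
  neval n (nclone (j + d) (desc_word j d)) = desc n j d * desc n j.+1 d /\
  nperm (desc_word j d) (j + d) = j.
Proof.
elim: d => [|d [IH1 IH2]]; first by rewrite /= neval_nil !desc0 mulg1 addn0.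
rewrite /= -/(nclone_letter _ (_, _)).
case: ncloneP => h; try (exfalso; lia); rewrite /= !neval_cons IH1 IH2.
split=> //; rewrite /sgen /= !descS !addSn -!mulgA; congr (_ * _).
rewrite !mulgA; congr (_ * _); apply: desc_comm_below; lia.
Qed.

(** Cloning a strand which the band does not link only changes the gaps;
    cloning one of the linked strands gives the product of the bands to its
    two copies. *)
Section CloneBand.
Variables (n j d : nat).
Hypothesis dn : (j + d.+1 < n)%N.

Let sq := [:: (j, false); (j, false)].

Let clone_bandE (k : 'I_n) :
  clone k (band n j d) =
  neval n.+1 (nclone (nperm (desc_word j.+1 d) k) sq) ^
  (neval n.+1 (nclone k (desc_word j.+1 d)))^-1.
Proof.
have [|ck pk] := @clone_neval n k (desc_word j.+1 d).
  by apply: desc_word_range; lia.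
rewrite /band clone_conjV; last exact: pure_gen_sq.
rewrite /desc ck; congr (_ ^ _).
have -> : gen n j * gen n j = neval n sq.
  by rewrite !neval_cons neval_nil mulg1.
have [|-> _] := @clone_neval n (braid_perm (neval n (desc_word j.+1 d)) k) sq.
  by rewrite /=; lia.
by rewrite pk.
Qed.

Let sqE m i : gen m i * gen m i = neval m [:: (i, false); (i, false)].
Proof. by rewrite !neval_cons neval_nil mulg1. Qed.

Lemma clone_band_left (k : 'I_n) : (k < j)%N ->
  clone k (band n j d) = band n.+1 j.+1 d.
Proof.
move=> kj; rewrite clone_bandE.
have [|-> ->] := @nclone_desc_below j.+1 d k; first lia.
rewrite /sq !nclone_cons; do 2 (case: ncloneP => ?; try (exfalso; lia)).
by rewrite /band sqE.
Qed.

Lemma clone_band_mid (k : 'I_n) : (j < k < j + d.+1)%N ->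
  clone k (band n j d) = band n.+1 j d.+1.
Proof.
move=> kj; rewrite clone_bandE.
have [|-> ->] := @nclone_desc_mid j.+1 d k; first lia.
rewrite /sq !nclone_cons; do 2 (case: ncloneP => ?; try (exfalso; lia)).
by rewrite /band sqE.
Qed.

Lemma clone_band_right (k : 'I_n) : (j + d.+1 < k)%N ->
  clone k (band n j d) = band n.+1 j d.
Proof.
move=> kj; rewrite clone_bandE.
have [|-> ->] := @nclone_desc_above j.+1 d k; first lia.
rewrite /sq !nclone_cons; do 2 (case: ncloneP => ?; try (exfalso; lia)).
by rewrite /band sqE.
Qed.

Lemma clone_band_first (k : 'I_n) : k = j :> nat ->
  clone k (band n j d) = band n.+1 j d.+1 * band n.+1 j.+1 d.
Proof.
move=> kj; rewrite clone_bandE.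
have [|-> ->] := @nclone_desc_below j.+1 d k; first lia.
rewrite /sq !nclone_cons; do 2 (case: ncloneP => ?; try (exfalso; lia)).
rewrite /= !neval_cons neval_nil mulg1 /sgen /= -/(desc _ _ _) /band.
rewrite desc_rcons invgM conjgM -conjMg; congr (_ ^ _).
by rewrite /conjg invgK -!mulgA mulKg.
Qed.

Lemma clone_band_last (k : 'I_n) : k = (j + d.+1)%N :> nat ->
  clone k (band n j d) = band n.+1 j d * band n.+1 j d.+1.
Proof.
move=> kj; rewrite clone_bandE kj -addSnnS.
have [-> ->] := nclone_desc_last n.+1 j.+1 d.
rewrite /sq !nclone_cons; do 2 (case: ncloneP => ?; try (exfalso; lia)).
rewrite /= !neval_cons neval_nil mulg1 /sgen /= /band.
set s0 := gen _ j; set s1 := gen _ j.+1.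
set D := desc _ j.+1 d; set D' := desc _ j.+2 d.
have C : commute s0 D' by apply: desc_comm_above.
(* Strands of two successive descents stay parallel: the longer descent can be
   made first, the other one then being shifted by one position. *)
have CDe e : (e <= d)%N -> desc n.+1 j.+1 e * desc n.+1 j.+1 d.+1 =
    desc n.+1 j.+1 d.+1 * desc n.+1 j.+2 e.
  elim: e => [|e IH] ed; first by rewrite !desc0 mulg1 mul1g.
  rewrite !(descS _ _ e) -mulgA IH ?mulgA; last exact: ltnW.
  by rewrite desc_shift //; lia.
have CD : D * desc n.+1 j.+1 d.+1 = desc n.+1 j.+1 d.+1 * D' := CDe d (leqnn d).
have -> : s0 * (s1 * (s1 * s0)) = (s0 * s0) * ((s0 * s0) ^ s1^-1).
  have B : s0 * (s1 * s0) = s1 * (s0 * s1) by apply: gen_braid; lia.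
  rewrite /conjg invgK; apply: (mulIg s1); rewrite -!mulgA mulVg mulg1.
  have Bx x : s0 * (s1 * (s0 * x)) = s1 * (s0 * (s1 * x)).
    by apply: gen_braidx; lia.
  by congr (s0 * _); rewrite Bx -B.
have C2 : commute (s0 * s0) D'^-1.
  by apply: commuteV; apply/commute_sym; apply: commuteM; apply/commute_sym.
rewrite conjMg -conjgM; congr (_ * _).
  by rewrite invgM conjgM [X in X ^ _]/conjg C2 mulKg.
rewrite -invgM -(mulgA D) /D' -desc_rcons CD invgM conjgM.
by rewrite [X in X ^ _]/conjg C2 mulKg.
Qed.
End CloneBand.

(** * Cloning invariant families of morphisms on pure braid groups *)

Section CloningInvariant.
Variables (Q : groupType) (x : forall n, PB n -> Q).
Hypothesis xM : forall n, {morph @x n : p q / p * q}.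
Hypothesis xC : forall n (k : 'I_n) p, x (kappa k p) = x p.

Let v n j d : Q := x (PureBraid (pure_band n j d)).

Let v_clone n j d (k : 'I_n) n' j' d' :
  clone k (band n j d) = band n.+1 j' d' -> n' = n.+1 -> v n j d = v n' j' d'.
Proof.
by move=> E ->; rewrite /v -(xC k); congr (x _); apply: val_inj.
Qed.

Let v_clone2 n j d (k : 'I_n) n' j' d' j'' d'' :
  clone k (band n j d) = band n.+1 j' d' * band n.+1 j'' d'' -> n' = n.+1 ->
  v n j d = v n' j' d' * v n' j'' d''.
Proof.
by move=> E ->; rewrite /v -xM -(xC k); congr (x _); apply: val_inj.
Qed.

(** The value on a band as a function of the three gaps: [j] strands on the
    left of it, [d] inside and [r] on its right. *)
Let t j d r := v (j + d + r).+2 j d.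

Let t_left j d r : t j.+2 d r = t j.+1 d r.
Proof.
have k0 : (0 < (j.+1 + d + r).+2)%N by [].
by rewrite /t (@v_clone _ j.+1 d (Ordinal k0) (j.+2 + d + r).+2 j.+2 d) //
  clone_band_left //=; lia.
Qed.

Let t_mid j d r : t j d.+2 r = t j d.+1 r.
Proof.
have kd : (j.+1 < (j + d.+1 + r).+2)%N by lia.
rewrite /t (@v_clone _ j d.+1 (Ordinal kd) (j + d.+2 + r).+2 j d.+2) //.
  by rewrite clone_band_mid //=; lia.
by lia.
Qed.

Let t_right j d r : t j d r.+2 = t j d r.+1.
Proof.
have kr : ((j + d).+2 < (j + d + r.+1).+2)%N by lia.
rewrite /t (@v_clone _ j d (Ordinal kr) (j + d + r.+2).+2 j d) //.
  by rewrite clone_band_right //=; lia.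
by lia.
Qed.

Let t_first j d r : t j d r = t j d.+1 r * t j.+1 d r.
Proof.
have kj : (j < (j + d + r).+2)%N by lia.
rewrite /t (@v_clone2 _ j d (Ordinal kj) (j + d.+1 + r).+2 j d.+1 j.+1 d);
  last by lia.
  by congr (_ * v _ _ _); lia.
by rewrite clone_band_first //=; lia.
Qed.

Let t_last j d r : t j d r = t j d r.+1 * t j d.+1 r.
Proof.
have kj : ((j + d).+1 < (j + d + r).+2)%N by lia.
rewrite /t (@v_clone2 _ j d (Ordinal kj) (j + d + r.+1).+2 j d j d.+1);
  last by lia.
  by congr (_ * v _ _ _); lia.
by rewrite clone_band_last //=; lia.
Qed.

Let t_gaps j d r : t j d r = t (0 < j) (0 < d) (0 < r).
Proof.
have -> : t j d r = t (0 < j) d r.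
  by elim: j => [|[|j] IH] //; rewrite t_left IH.
move: (0 < j)%N => {}j; have -> : t j d r = t j (0 < d) r.
  by elim: d => [|[|d] IH] //; rewrite t_mid IH.
move: (0 < d)%N => {}d.
by elim: r => [|[|r] IH] //; rewrite t_right IH.
Qed.

(** [c] belongs to a band between neighbours with strands on both sides, [g] to a
    band between the first and the last of at least three strands. *)
Let c := t 1 0 1.
Let g := t 0 1 0.

(** All values lie in every subgroup that contains [c] and [g].  Write the value
    with gaps of sizes 0 or 1 as t j d r.  Cloning the first linked strand gives
    t 1 1 r = t 1 1 r * t 1 1 r, and cloning the second one does the same for
    t 0 1 1, so these are trivial; the other values are then products of c
    and g. *)
Let t_in (K : set Q) : subgroup_closed K -> K c -> K g ->
  forall j d r, K (t j d r).
Proof.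
move=> Kc Kcc Kg j d r; rewrite t_gaps.
have t110 e : t 1 1 e = 1.
  by apply: idempotent_trivial; rewrite {1}t_first t_mid t_left.
have t011 : t 0 1 1 = 1.
  by apply: idempotent_trivial; rewrite {1}t_last t_right t_mid.
have t100 : t 1 0 0 = c by rewrite t_last t110 mulg1.
have t001 : t 0 0 1 = c by rewrite t_first t011 mul1g.
have t000 : t 0 0 0 = g * c by rewrite t_first t100.
have K1 := Kc.1.
case: (0 < j)%N; case: (0 < d)%N; case: (0 < r)%N => /=;
  rewrite ?t110 ?t011 ?t100 ?t001 ?t000 //.
exact: subgroup_mul.
Qed.

(** The set to which the induction is applied carries the proof of purity along,
    since [x] is only defined on pure braids. *)
Let x_in (K : set Q) : subgroup_closed K -> K c -> K g ->
  forall n (p : PB n), K (x p).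
Proof.
move=> Kc Kcc Kg n p.
have [] // : [set b | exists2 h : pure b, K (x (PureBraid h)) & True] (pbval p).
  apply: pure_braid_ind (valP p).
    have xV := morphV (@xM n).
    split=> [|a b [ha Ka _] [hb Kb _]].
      exists (valP (1 : PB n)) => //.
      rewrite (_ : PureBraid _ = 1) ?(morph1 (@xM n)); first exact: Kc.1.
      exact: val_inj.
    exists (valP (PureBraid ha * (PureBraid hb)^-1)) => //.
    rewrite (_ : PureBraid _ = PureBraid ha * (PureBraid hb)^-1).
      by rewrite xM xV; apply: Kc.2.
    exact: val_inj.
  move=> j d jd; exists (pure_band n j d) => //.
  have -> : x (PureBraid (pure_band n j d)) = t j d (n - (j + d).+2).
    by rewrite /t -/(v n j d); congr (v _ _ _); lia.
  exact: t_in.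
by move=> h Kx _; rewrite (_ : p = PureBraid h) //; apply: val_inj.
Qed.

(** The bands with values c and g can be taken to be A_(1,2) and A_(0,3) on four
    strands, which commute.  The rest is a triple application of [x_in] to
    centralisers. *)
Lemma cloning_invariant_commute n m (p : PB n) (q : PB m) :
  commute (x p) (x q).
Proof.
have cg : commute c g.
  rewrite /g -t_mid; rewrite /c /t /commute -!xM /=; congr (x _).
  apply: val_inj => /=.
  have C : commute (gen 4 1) (band 4 0 2) by apply: band_far => //; right.
  (* A_(1,2) is the square of sigma_1. *)
  rewrite {1 4}/band desc0 invg1 conjg1.
  by apply/commute_sym/commuteM; apply/commute_sym.
have xc n' (p' : PB n') : commute (x p') c.
  apply: (x_in (centraliser_closed c)) => //=; exact/commute_sym.
have xg n' (p' : PB n') : commute (x p') g.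
  by apply: (x_in (centraliser_closed g)).
by apply: (x_in (centraliser_closed (x q))); apply/commute_sym.
Qed.
End CloningInvariant.

(** * Slides in Thompson's group *)

(** The element (T, 1, S), with a default value when the numbers of leaves
    differ, so that trees can be rewritten without transporting proofs about
    their leaves. *)
Definition tree_pair (T S : tree) : Fbr :=
  if leaves S == leaves T =P true is ReflectT h
  then Fbr_class (Triple (1 : PB (leaves T)) (eqxx (leaves T)) h) else 1.

Lemma tree_pairE n T S (hT : leaves T == n) (hS : leaves S == n) :
  tree_pair T S = Fbr_class (Triple 1 hT hS).
Proof.
have E := eqP hT; subst n; rewrite /tree_pair; case: eqP => [h|/negP]; last first.
  by rewrite hS.
by congr Fbr_class; apply: triple_eq.
Qed.

Lemma tree_pairM T S U : leaves T = leaves S -> leaves S = leaves U ->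
  tree_pair T S * tree_pair S U = tree_pair T U.
Proof.
move=> /eqP TS SU; have hU : leaves U == leaves S by rewrite SU.
by rewrite (tree_pairE TS (eqxx _)) (tree_pairE (eqxx _) hU) FbrM mulg1
  (tree_pairE TS hU).
Qed.

Lemma tree_pair1 T : tree_pair T T = 1.
Proof. by rewrite (tree_pairE (eqxx _) (eqxx _)); apply: Fbr_oneE. Qed.

Lemma tree_pairV T S : leaves T = leaves S ->
  (tree_pair T S)^-1 = tree_pair S T.
Proof.
by move=> TS; apply: (mulgI (tree_pair T S)); rewrite mulgV tree_pairM ?tree_pair1.
Qed.

Lemma class_expand n T S (p : PB n) (hT : leaves T == n) (hS : leaves S == n)
    (k : 'I_n) (hT' : leaves (add_caret T k) == n.+1)
    (hS' : leaves (add_caret S k) == n.+1) :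
  Fbr_class (Triple p hT hS) = Fbr_class (Triple (kappa k p) hT' hS').
Proof.
rewrite (red_class (@red_step (Triple p hT hS) k)) /expand /=.
by congr Fbr_class; apply: triple_eq.
Qed.

Lemma tree_pair_caret T S k : leaves T = leaves S -> (k < leaves T)%N ->
  tree_pair (add_caret T k) (add_caret S k) = tree_pair T S.
Proof.
move=> TS kT; have hS : leaves S == leaves T by rewrite TS.
have hT' : leaves (add_caret T k) == (leaves T).+1 by rewrite leaves_add_caret.
have hS' : leaves (add_caret S k) == (leaves T).+1.
  by rewrite leaves_add_caret TS.
rewrite (tree_pairE (eqxx _) hS) (@class_expand _ _ _ _ _ _ (Ordinal kT) hT' hS').
by rewrite kappa1 (tree_pairE hT' hS').
Qed.

Lemma add_caretC T k l : (k < l < leaves T)%N ->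
  add_caret (add_caret T l) k = add_caret (add_caret T k) l.+1.
Proof.
move=> kl; have := @add_caret_comm T k l; rewrite /nbump.
have -> : (l < k)%N = false by lia.
have -> : (k < l)%N by lia.
by rewrite addn0 addn1; apply; lia.
Qed.

Lemma leaf_unique T : (leaves T <= 1)%N -> T = Leaf.
Proof.
by case: T => //= L R; have := leaves_gt0 L; have := leaves_gt0 R; lia.
Qed.

Lemma add_caret_exists T : (1 < leaves T)%N ->
  exists S k, [/\ (k < leaves S)%N & T = add_caret S k].
Proof.
elim: T => //= L IHL R IHR _; have [L1|L1] := ltnP 1 (leaves L).
  have [S [k [kS E]]] := IHL L1.
  exists (Node S R), k => /=; split; first by have := leaves_gt0 R; lia.
  by rewrite kS -E.
have [R1|R1] := ltnP 1 (leaves R).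
  have [S [k [kS E]]] := IHR R1.
  exists (Node L S), (leaves L + k)%N => /=; split; first lia.
  by rewrite ifF ?addKn -?E //; lia.
exists Leaf, 0%N; split=> //=.
by rewrite (leaf_unique L1) (leaf_unique R1).
Qed.

(** The caret hanging from leaf [k] slides to leaf [k.+1]. *)
Definition slide (S : tree) (k : nat) : Fbr :=
  tree_pair (add_caret S k) (add_caret S k.+1).

Lemma slide_right S j k : (k.+1 < j < leaves S)%N ->
  slide (add_caret S j) k = slide S k.
Proof.
move=> kj; rewrite /slide !(@add_caretC S _ j); try lia.
by rewrite tree_pair_caret ?leaves_add_caret //; lia.
Qed.

Lemma slide_left S j k : (j < k)%N -> (k.+1 < leaves S)%N ->
  slide (add_caret S j) k.+1 = slide S k.
Proof.
move=> jk kS; rewrite /slide -!add_caretC; try lia.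
by rewrite tree_pair_caret ?leaves_add_caret //; lia.
Qed.

Lemma slide_split_left S k : (k.+1 < leaves S)%N ->
  slide S k = slide (add_caret S k) k * slide (add_caret S k) k.+1.
Proof.
move=> kS; rewrite /slide tree_pairM ?leaves_add_caret // -add_caretC; last lia.
by rewrite tree_pair_caret ?leaves_add_caret //; lia.
Qed.

Lemma slide_split_right S k : (k.+1 < leaves S)%N ->
  slide S k = slide (add_caret S k.+1) k * slide (add_caret S k.+1) k.+1.
Proof.
move=> kS; rewrite /slide tree_pairM ?leaves_add_caret //.
rewrite (@add_caretC S k k.+1); last lia.
by rewrite tree_pair_caret ?leaves_add_caret //; lia.
Qed.

(** Adding carets to S and S' at the same leaf, be it k or k.+1, does not change
    the tree pair that they form. *)
Lemma slide_conj S S' k : leaves S = leaves S' -> (k.+1 < leaves S)%N ->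
  slide S' k = slide S k ^ tree_pair S S'.
Proof.
move=> SS kS; rewrite /conjg tree_pairV // mulgA /slide.
rewrite -(@tree_pair_caret S' S k) //; try lia.
rewrite -(@tree_pair_caret S S' k.+1) //; try lia.
by rewrite !tree_pairM ?leaves_add_caret //; lia.
Qed.

Section SlideGeneration.
Variable K : set Fbr.
Hypothesis Kc : subgroup_closed K.

Lemma caret_moves_in S a b : (a <= b)%N ->
  (forall k, (a <= k < b)%N -> K (slide S k)) ->
  K (tree_pair (add_caret S a) (add_caret S b)).
Proof.
move=> /subnKC <-; elim: (b - a)%N => [|d IH] KS.
  by rewrite addn0 tree_pair1; apply: Kc.1.
rewrite -(@tree_pairM _ (add_caret S (a + d))) ?leaves_add_caret // addnS.
apply: (subgroup_mul Kc); last by apply: KS; lia.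
by apply: IH => k ?; apply: KS; lia.
Qed.

(** Slides generate Thompson's group.  If T and S are obtained from T' and S' by
    adding carets at the leaves k and l, then (T, 1, S) is the product of
    (T', 1, S') and of an element that moves a caret below S' from leaf k to
    leaf l. *)
Lemma tree_pair_in : (forall S k, (k.+1 < leaves S)%N -> K (slide S k)) ->
  forall T S, K (tree_pair T S).
Proof.
move=> KS T S; have [TS|TS] := eqVneq (leaves S) (leaves T); last first.
  rewrite /tree_pair; case: eqP => [h|_]; last exact: Kc.1.
  by rewrite h in TS.
elim: {T}(leaves T).+1 {-2}T (ltnSn (leaves T)) S TS => // m IH T Tm S TS.
have [T1|T1] := ltnP 1 (leaves T); last first.
  have S1 : (leaves S <= 1)%N by rewrite TS.
  by rewrite (leaf_unique T1) (leaf_unique S1) tree_pair1; apply: Kc.1.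
have [T' [k [kT ET]]] := add_caret_exists T1.
have [|S' [l [lS ES]]] := @add_caret_exists S; first by rewrite TS.
subst T S; rewrite !leaves_add_caret in TS Tm *; case: TS => TS.
rewrite -(@tree_pairM _ (add_caret S' k)) ?leaves_add_caret ?TS //.
rewrite tree_pair_caret //; apply: (subgroup_mul Kc); first exact: IH.
have [kl|/ltnW lk] := leqP k l.
  by apply: caret_moves_in => // i ?; apply: KS; lia.
rewrite -tree_pairV ?leaves_add_caret //; apply: (subgroup_inv Kc).
by apply: caret_moves_in => // i ?; apply: KS; lia.
Qed.
End SlideGeneration.

(** An interior slide at k is the product of the interior slides at k and k.+1
    on the tree with a caret added at k.  Moving that caret to a leaf further
    right (for the first factor) or further left (for the second one) is a
    conjugation by interior slides, which does not affect the image, and makes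
    both factors equal to the slide at k on the original tree. *)
Section Interior.
Variables (Q : groupType) (f : Fbr -> Q).
Hypothesis fM : {morph f : x y / x * y}.
Hypothesis f_comm : forall S k S' k', (0 < k)%N -> (k.+2 < leaves S)%N ->
  (0 < k')%N -> (k'.+2 < leaves S')%N ->
  commute (f (slide S k)) (f (slide S' k')).

Let commuting_conj x y : commute (f y) (f x) -> f (x ^ y) = f x.
Proof.
by move=> C; rewrite /conjg !fM (morphV fM) -C mulKg.
Qed.

(** The bounds leave an interior leaf on each side of k and k.+1, to which the
    caret can go. *)
Let deep_interior_slide S k : (1 < k)%N -> (k.+3 < leaves S)%N ->
  f (slide S k) = 1.
Proof.
move=> k1 kS; apply: idempotent_trivial; rewrite {1}slide_split_left ?fM;
  last lia.
have Cc := preim_closed fM (centraliser_closed (f (slide S k))).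
congr (_ * _).
- have E : slide (add_caret S k.+2) k = slide S k by apply: slide_right; lia.
  rewrite (@slide_conj (add_caret S k.+2)) ?leaves_add_caret //; last lia.
  rewrite E; apply: commuting_conj.
  rewrite -tree_pairV ?leaves_add_caret //; apply: (subgroup_inv Cc).
  by apply: (caret_moves_in Cc) => [|i ?]; [lia|apply: f_comm; lia].
- have E : slide (add_caret S 1) k.+1 = slide S k by apply: slide_left; lia.
  rewrite (@slide_conj (add_caret S 1)) ?leaves_add_caret //; last lia.
  rewrite E; apply: commuting_conj.
  by apply: (caret_moves_in Cc) => [|i ?]; [lia|apply: f_comm; lia].
Qed.

Lemma interior_slide_trivial S k : (0 < k)%N -> (k.+2 < leaves S)%N ->
  f (slide S k) = 1.
Proof.
move=> k0 kS; rewrite -(@slide_right S (leaves S).-1); last lia.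
rewrite -(@slide_left _ 0) ?leaves_add_caret //; last lia.
by apply: deep_interior_slide; rewrite ?leaves_add_caret; lia.
Qed.
End Interior.

(** * Pure elements *)

(** Three parallel copies of strand k are obtained by cloning either of the two
    copies. *)
Lemma kappa_twice n (k : 'I_n) (k1 k2 : 'I_n.+1) (p : PB n) :
  k1 = k :> nat -> k2 = k.+1 :> nat ->
  kappa k1 (kappa k p) = kappa k2 (kappa k p).
Proof.
move=> E1 E2; apply: val_inj => /=; rewrite -(clsK p) !clone_cls !cls_neval.
rewrite !nword_clone E1 E2; congr neval.
move: (nword _) (nat_of_ord k) => w l; elim: w l => [//|[i e] w IH] l.
rewrite !nclone_cons; case: ncloneP => h;
  rewrite !nclone_cat; ncases;
  rewrite /= ?IH //; try (exfalso; lia).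
Qed.

Definition pure_elt n T (p : PB n) (hT : leaves T == n) : Fbr :=
  Fbr_class (Triple p hT hT).

Lemma pure_eltM n T (p q : PB n) (hT : leaves T == n) :
  pure_elt (p * q) hT = pure_elt p hT * pure_elt q hT.
Proof. by rewrite /pure_elt FbrM. Qed.

Lemma pure_elt_caret n T (p : PB n) (hT : leaves T == n) (k : 'I_n) :
  pure_elt p hT = pure_elt (kappa k p) (expand_leaves k hT).
Proof. exact: class_expand. Qed.

Lemma pure_elt_conj n T S (p : PB n) (hT : leaves T == n) (hS : leaves S == n) :
  pure_elt p hS = pure_elt p hT ^ tree_pair T S.
Proof.
rewrite /conjg tree_pairV ?(eqP hT) ?(eqP hS) //.
by rewrite (tree_pairE hT hS) (tree_pairE hS hT) /pure_elt !FbrM mulg1 mul1g.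
Qed.

(** Both trees of the slide are obtained from T by adding two carets below leaf
    k, and by [kappa_twice] the corresponding expansions of the pure element
    carry the same braid. *)
Lemma pure_elt_slide n T (p : PB n) (hT : leaves T == n) (k : 'I_n) :
  commute (pure_elt p hT) (slide (add_caret T k) k).
Proof.
have lt1 : (k < n.+1)%N by apply: leqW.
pose k1 : 'I_n.+1 := Ordinal lt1.
pose k2 : 'I_n.+1 := Ordinal (ltn_ord k : (k.+1 < n.+1)%N).
have h := expand_leaves k hT.
have h1 := expand_leaves k1 h; have h2 := expand_leaves k2 h.
rewrite /commute {1}(pure_elt_caret p hT k) (pure_elt_caret _ _ k1).
rewrite (pure_elt_caret p hT k) (pure_elt_caret _ _ k2).
rewrite /slide (tree_pairE h1 h2) /pure_elt.
rewrite (eq_irrelevance (expand_leaves k1 _) h1).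
rewrite (eq_irrelevance (expand_leaves k2 _) h2) !FbrM mulg1 mul1g.
by rewrite (@kappa_twice _ k k1 k2).
Qed.

(** Any two trees have a common expansion. *)
Lemma caret_invariant (X : Type) (f : tree -> X) m :
  (forall S j, (m < leaves S)%N -> (j < leaves S)%N ->
     f (add_caret S j) = f S) ->
  forall S S', (m < leaves S)%N -> (m < leaves S')%N -> f S = f S'.
Proof.
move=> fE; have up R S : tle S R -> (m < leaves S)%N -> f S = f R.
  elim: {S}(leaves R - leaves S).+1 {-2}S (ltnSn (leaves R - leaves S)) => //.
  move=> e IH S Se SR mS.
  have [->//|[j jS jR]] := tle_ext SR.
  rewrite -(fE _ _ mS jS); have := tle_leaves jR.
  by move=> lR; apply: IH => //; rewrite leaves_add_caret in lR *; lia.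
move=> S S' mS mS'; rewrite (up (tjoin S S')) ?tle_joinl //.
by rewrite -(up (tjoin S S') S') ?tle_joinr.
Qed.

(** * Images of the group in which interior slides are trivial *)

Fixpoint vine (m : nat) : tree :=
  if m is m'.+1 then Node Leaf (vine m') else Leaf.

Lemma vine_leaves m : leaves (vine m) == m.+1.
Proof. by elim: m => //= m /eqP->. Qed.

Section CommutativeImage.
Variables (Q : groupType) (f : Fbr -> Q).
Hypothesis fM : {morph f : x y / x * y}.
Hypothesis f_interior : forall S k, (0 < k)%N -> (k.+2 < leaves S)%N ->
  f (slide S k) = 1.

Let first S := f (slide S 0).
Let final S := f (slide S (leaves S).-2).

(** A caret on leaf 0 or 1 splits the slide at 0; one of the two factors is
    interior. *)
Let first_caret S j : (2 < leaves S)%N -> (j < leaves S)%N ->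
  first (add_caret S j) = first S.
Proof.
move=> S2 jS; rewrite /first; case: j jS => [|[|j]] jS.
- rewrite [in RHS]slide_split_left ?fM; last lia.
  by rewrite (@f_interior _ 1) ?mulg1 // leaves_add_caret; lia.
- rewrite [in RHS]slide_split_right ?fM; last lia.
  by rewrite (@f_interior _ 1) ?mulg1 // leaves_add_caret; lia.
- by rewrite slide_right.
Qed.

Let final_caret S j : (2 < leaves S)%N -> (j < leaves S)%N ->
  final (add_caret S j) = final S.
Proof.
move=> S2 jS; rewrite /final leaves_add_caret /=.
have [k kE] : exists k, leaves S = k.+2 by exists (leaves S).-2; lia.
rewrite kE /=; have [jk|[jk|jk]] : (j < k \/ (j = k \/ j = k.+1))%N by lia.
- by rewrite slide_left //; lia.
- subst j; rewrite [in RHS]slide_split_left ?fM; last lia.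
  by rewrite (@f_interior _ k) ?mul1g // ?leaves_add_caret; lia.
- subst j; rewrite [in RHS]slide_split_right ?fM; last lia.
  by rewrite (@f_interior _ k) ?mul1g // ?leaves_add_caret; lia.
Qed.

Let a := first (vine 3).
Let b := final (vine 3).

Let firstE S : (2 < leaves S)%N -> first S = a.
Proof. by move=> S2; apply: (caret_invariant first_caret). Qed.

Let finalE S : (2 < leaves S)%N -> final S = b.
Proof. by move=> S2; apply: (caret_invariant final_caret). Qed.

(** On a tree with two leaves the only slide is at once first and last; it
    splits into slides on a tree with three leaves. *)
Let pair_in (K : set Q) : subgroup_closed K -> K a -> K b ->
  forall T S, K (f (tree_pair T S)).
Proof.
move=> Kc Ka Kb; apply: (tree_pair_in (preim_closed fM Kc)) => S k kS /=.
have edge k' S' : (2 < leaves S')%N -> (k'.+1 < leaves S')%N ->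
    K (f (slide S' k')).
  move=> S2 kS'; have [->|k0] := posnP k'; first by rewrite -/(first _) firstE.
  have [lt|ge] := ltnP k'.+2 (leaves S').
    by rewrite f_interior //; apply: Kc.1.
  have -> : k' = (leaves S').-2 by lia.
  by rewrite -/(final _) finalE.
have [S2|S2] := ltnP 2 (leaves S); first exact: edge.
rewrite slide_split_left // fM; apply: (subgroup_mul Kc);
  by apply: edge; rewrite leaves_add_caret; lia.
Qed.

(** A slide at leaf 2 is itself the tree pair that carries one tree with a caret
    far from leaf 0 to another one, and this does not change the slide at 0. *)
Let ab_comm : commute a b.
Proof.
pose S := add_caret (vine 3) 2; pose S' := add_caret (vine 3) 3.
have -> : a = f (slide S 0) by rewrite -/(first S) firstE.
have -> : b = f (slide (vine 3) 2) by [].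
have E : slide S' 0 = slide S 0 by rewrite !slide_right.
rewrite /commute -!fM; congr f; apply/commgP; rewrite -conjg_fix.
by rewrite -[slide _ 2]/(tree_pair S S') -slide_conj //= E.
Qed.

Let pair_pair T S T' S' : commute (f (tree_pair T S)) (f (tree_pair T' S')).
Proof.
have aP U V : commute (f (tree_pair U V)) a.
  by apply: (pair_in (centraliser_closed a)) => //=; apply/commute_sym.
have bP U V : commute (f (tree_pair U V)) b.
  by apply: (pair_in (centraliser_closed b)).
by apply: (pair_in (centraliser_closed _)); apply/commute_sym.
Qed.

(** The slides below the first and the last leaf of T have the images a and
    b. *)
Let pair_pure U V n T (p : PB n) (hT : leaves T == n) :
  commute (f (tree_pair U V)) (f (pure_elt p hT)).
Proof.
(* The trees T + caret need three leaves for [firstE] and [finalE]. *)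
wlog n2 : n T p hT / (1 < n)%N => [H|].
  have n0 : (0 < n)%N by rewrite -(eqP hT) leaves_gt0.
  by rewrite (pure_elt_caret p hT (Ordinal n0)); apply: H.
have sC (k : 'I_n) : commute (f (slide (add_caret T k) k)) (f (pure_elt p hT)).
  by rewrite /commute -!fM; congr f; apply/esym/pure_elt_slide.
apply: (pair_in (centraliser_closed _)) => /=.
  have n0 : (0 < n)%N by lia.
  by rewrite -(@firstE (add_caret T 0)) ?leaves_add_caret ?(eqP hT) //;
    apply: (sC (Ordinal n0)).
have n1 : (n.-1 < n)%N by lia.
have -> : b = f (slide (add_caret T n.-1) n.-1).
  rewrite -(@finalE (add_caret T n.-1)) /final ?leaves_add_caret ?(eqP hT) //.
exact: (sC (Ordinal n1)).
Qed.

Let pure_tree n T S (p : PB n) (hT : leaves T == n) (hS : leaves S == n) :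
  f (pure_elt p hT) = f (pure_elt p hS).
Proof.
rewrite [in RHS](pure_elt_conj p hT hS) /conjg !fM (morphV fM).
by rewrite -(pair_pure _ _ p hT) mulKg.
Qed.

(** The value on (T, p, T), read off on one tree for each number of leaves;
    there is no tree with 0 leaves, where the trivial morphism does. *)
Let x n : PB n -> Q :=
  if n is m.+1 then fun p => f (pure_elt p (vine_leaves m)) else fun=> 1.

Let xE n T (p : PB n) (hT : leaves T == n) : f (pure_elt p hT) = x p.
Proof.
case: n p hT => [|m] p hT; last exact: pure_tree.
by have := leaves_gt0 T; rewrite (eqP hT).
Qed.

Lemma commutative_image g h : commute (f g) (f h).
Proof.
have xM n : {morph @x n : p q / p * q}.
  case: n => [|m] p q; first by rewrite /= mulg1.
  by rewrite /= pure_eltM fM.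
have xC n (k : 'I_n) p : x (kappa k p) = x p.
  case: n k p => [[]//|m] k p.
  by rewrite -(xE p (vine_leaves m)) (pure_elt_caret _ _ k) xE.
have factor g' : exists n (p : PB n) T S, f g' = x p * f (tree_pair T S).
  rewrite -(Fbr_classK g'); case: (repr g') => n T p S hT hS.
  exists n, p, T, S; rewrite -(xE p hT) -fM (tree_pairE hT hS).
  by rewrite /pure_elt FbrM mulg1.
have pair_x U V n (p : PB n) : commute (f (tree_pair U V)) (x p).
  case: n p => [|m] p; first exact: commute1.
  exact: pair_pure.
have [n [p [T [S ->]]]] := factor g; have [m [q [T' [S' ->]]]] := factor h.
apply: commuteM; apply/commute_sym/commuteM => //.
- exact: cloning_invariant_commute.
- exact/commute_sym.
Qed.
End CommutativeImage.

(** [interior_slide_trivial] is used twice.  The quotient by the derived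
    subgroup is commutative, so interior slides lie in that subgroup, and
    therefore their images commute in the next quotient. *)
Lemma interior_slide_second_derived S k : (0 < k)%N -> (k.+2 < leaves S)%N ->
  second_derived Fbr (slide S k).
Proof.
have derived_slide S' k' : (0 < k')%N -> (k'.+2 < leaves S')%N ->
    derived Fbr (slide S' k').
  move=> k0 kS; apply/coset_eq1.
  apply: (interior_slide_trivial (@cosetM _ _)) => // *.
  by apply: coset_commute; apply: commutator_in.
move=> k0 kS; apply/coset_eq1.
apply: (interior_slide_trivial (@cosetM _ _)) => // *.
by apply: coset_commute; apply: commutator_in; apply: derived_slide.
Qed.

Theorem corollary2p2 : perfect (commutator_subgroup [set: Fbr] [set: Fbr]).
Proof.
apply/seteqP; split; first by apply: commutator_closed; apply: generated_closed.
apply: (@commutator_sub_normal _ (second_derived Fbr)) => x y.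
apply: (commutative_image (@cosetM _ _)) => S k k0 kS.
by apply/coset_eq1; apply: interior_slide_second_derived.
Qed.
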